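(* Let $1<\alpha<2$, $\gamma>0$, $\tau>0$, $\mathrm{a}<\mathrm{b}$, let $M\ge 8$ be even, $h=(\mathrm{b}-\mathrm{a})/(M+1)$, $\mu=\gamma\tau/h^\alpha$, let $D\in\mathbb{R}^{M\times M}$ be diagonal with nonpositive diagonal entries, and let $\omega>0$. Let $\theta,\theta_0$ be as in the context and $$\xi=\frac{2M^{1/2}\sqrt{1+\left\{\omega+2\left[\frac{\Gamma(\alpha+1)\mu}{\Gamma(\alpha/2+1)^2}-\frac{\theta\gamma\tau}{(\mathrm{b}-\mathrm{a})^\alpha}\right]\right\}^2}}{\sqrt{1+\left[\omega+\frac{2^{\alpha+1}\gamma\tau\theta}{(\mathrm{b}-\mathrm{a})^\alpha}\right]^2}\;\sqrt{1+\left[\omega+\frac{2\gamma\tau\theta}{(\mathrm{b}-\mathrm{a})^\alpha}\right]^2}}.$$ Let $\epsilon$ satisfy $2^\alpha\mu\theta_0/(M-2)^\alpha<\epsilon\le\mu\theta_0$ and $k_0=\lceil(\mu\theta_0/\epsilon)^{1/\alpha}\rceil+1$. Then there exist $\mathcal{M}_\omega,\mathcal{N}_\omega\in\mathbb{R}^{2M\times 2M}$ with $\mathrm{rank}(\mathcal{M}_\omega)=4k_0$, $\|\mathcal{M}_\omega\|_2\le\mu\xi\left[\frac{c_0}{2}-\frac{\theta}{(M-1/2)^\alpha}\right]$ and $\|\mathcal{N}_\omega\|_2\le\xi\epsilon$, such that $$\widetilde{\mathcal{F}}_\omega^{-1}\mathcal{R}=\mathcal{F}_\omega^{-1}\mathcal{R}+\mathcal{M}_\omega+\mathcal{N}_\omega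 .$$
   Context: $\theta=\frac{\left(1-\frac{1+\alpha}{5+\alpha/2}\right)^{5+\alpha/2}e^{1+\alpha}\Gamma(\alpha+1)\sin(\pi\alpha/2)}{\pi\alpha}$ and $\theta_0=\frac{\sqrt2\,e^{13/12}\Gamma(1+\alpha)\sin(\pi\alpha/2)}{\pi\alpha}$. For $k\in\mathbb{Z}$, $c_k=(-1)^k\Gamma(\alpha+1)/[\Gamma(\alpha/2-k+1)\Gamma(\alpha/2+k+1)]$ ($\Gamma$ the gamma function, $1/\Gamma=0$ at poles); in particular $c_0=\Gamma(\alpha+1)/\Gamma(\alpha/2+1)^2$. $T\in\mathbb{R}^{M\times M}$ is the symmetric Toeplitz matrix with entries $T_{jk}=\mu c_{j-k}$. For even $M$, $C\in\mathbb{R}^{M\times M}$ is Strang's circulant approximation of $T$: the symmetric circulant matrix whose first row is $\mu(c_0,c_1,\dots,c_{M/2-1},0,c_{M/2-1},\dots,c_1)$, each subsequent row being the cyclic right shift of the previous one. With $I$ the identity of the appropriate size, define $$\mathcal{R}=\begin{bmatrix}T-D & -I\\ I & T-D\end{bmatrix},\quad \mathcal{B}=\begin{bmatrix}-D&0\\0&-D\end{bmatrix},\quad \mathcal{H}=\begin{bmatrix}T&-I\\ I&T\end{bmatrix},\quad \mathcal{C}=\begin{bmatrix}C&-I\\ I&C\end{bmatrix},$$ $$\mathcal{F}_\omega=\tfrac{1}{2\omega}(\omega I+\mathcal{B})(\omega I+\mathcal{H}),\qquad \widetilde{\mathcal{F}}_\omega=\tfrac{1}{2\omega}(\omega I+\mathcal{B})(\omega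 I+\mathcal{C}).$$ $\|\cdot\|_2$ is the spectral norm. *)

(* Defs.v *)
From HB Require Import structures.
From mathcomp Require Import all_boot all_order all_algebra.
From mathcomp Require Import all_classical all_reals all_analysis.
Set Implicit Arguments. Unset Strict Implicit. Unset Printing Implicit Defensive.
Import Order.TTheory GRing.Theory Num.Theory.
Import numFieldNormedType.Exports.
Local Open Scope classical_set_scope.
Local Open Scope ring_scope.

Section Defs.
Variable R : realType.

Definition Gamma_pos (x : R) : R :=
  fine (\int[@lebesgue_measure R]_(t in `]0%R, +oo[)
          ((powR t (x - 1)) * expR (- t))%:E)%E.

(* Extension to all reals by Gamma(x) = Gamma(x+n) / (x (x+1) ... (x+n-1)),
   with n the least natural number such that x + n > 0 (n = 0 if x > 0).
   At the poles (x = 0,-1,-2,...) the product is 0, so Gamma x = 0 and,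
   with the MathComp convention 0^-1 = 0, (Gamma x)^-1 = 0, i.e. 1/Gamma = 0. *)
Definition Gamma_shift (x : R) : nat :=
  if 0 < x then 0%N else (`|Num.floor (- x)|%N).+1.

Definition Gamma (x : R) : R :=
  Gamma_pos (x + (Gamma_shift x)%:R) / \prod_(j < Gamma_shift x) (x + j%:R).

(* reciprocal Gamma, 1/Gamma, = 0 at poles *)
Definition rGamma (x : R) : R := (Gamma x)^-1.

Definition coef (alpha : R) (k : int) : R :=
  (-1) ^+ `|k|%N * Gamma (alpha + 1)
  * rGamma (alpha / 2 - k%:~R + 1) * rGamma (alpha / 2 + k%:~R + 1).

Definition theta (alpha : R) : R :=
  powR (1 - (1 + alpha) / (5 + alpha / 2)) (5 + alpha / 2)
  * expR (1 + alpha) * Gamma (alpha + 1) * sin (pi * alpha / 2) / (pi * alpha).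

Definition theta0 (alpha : R) : R :=
  Num.sqrt 2 * expR (13 / 12) * Gamma (1 + alpha) * sin (pi * alpha / 2)
  / (pi * alpha).

Definition toeplitzT (alpha mu : R) (M : nat) : 'M[R]_M :=
  \matrix_(j < M, k < M) (mu * coef alpha (j%:Z - k%:Z)).

(* first-row entries of Strang's circulant:
   (c_0, c_1, ..., c_{M/2-1}, 0, c_{M/2-1}, ..., c_1), index m in [0, M) *)
Definition strang_entry (alpha : R) (M m : nat) : R :=
  if (m < M./2)%N then coef alpha m%:Z
  else if m == M./2 then 0
  else coef alpha (M - m)%N%:Z.

(* circulant: row j is the first row cyclically shifted right j times,
   so C_{jk} = mu * r_{(k - j) mod M} *)
Definition strangC (alpha mu : R) (M : nat) : 'M[R]_M :=
  \matrix_(j < M, k < M) (mu * strang_entry alpha M ((k + M - j) %% M)%N).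

Definition vnorm2 (n : nat) (v : 'cV[R]_n) : R :=
  Num.sqrt (\sum_(i < n) v i 0 ^+ 2).

Definition spec_norm (m n : nat) (A : 'M[R]_(m, n)) : R :=
  sup [set vnorm2 (A *m v) | v in [set v : 'cV[R]_n | vnorm2 v <= 1]].

End Defs.

(* Main.v *)
(* Let [H], [B], [C] stand for the block matrices, [A1 = w + B], [A2 = w + H] and
   [A3 = w + C]. With [W = F^-1 R] one has [Ft^-1 R - W = A3^-1 (H - C) W], and
   [W = A2^-1 (1 - U V) A2] with the contractions [U = (w + B)^-1 (w - B)] and
   [V = (w - H) (w + H)^-1], so that [|W| <= 2 |A2^-1| |A2|]. As [T] and [C] are
   symmetric, [|A2|], [|A2^-1|] and [|A3^-1|] are controlled by the diagonal
   dominance of [T] and [C].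

   The matrix [T - C] is a symmetric Toeplitz matrix supported in two opposite
   corners. Its outermost triangles of size [k0] have rank exactly [2 k0] and
   yield [Mw]; the remaining diagonals yield [Nw]. All norms reduce to the tails
   [\sum_(k >= m) |c_k| = (m + alpha / 2) |c_m| / alpha], which equal
   [Gamma (alpha + 1) / (2 Gamma (1 + s) Gamma (1 - s)) * Gamma (m - s) / Gamma (m + s)]
   for [s = alpha / 2]. They are compared with [theta] and [theta0] using only
   [Gamma (x + s) <= x^s Gamma x]: the numerical slack in these constants makes
   the bounds [1 / 2 <= Gamma (1 + s) Gamma (2 - s) <= 1] a sufficient substitute
   for the reflection formula. *)

Require Import Defs.
From HB Require Import structures.
From mathcomp Require Import all_boot all_order all_algebra.
From mathcomp Require Import all_classical all_reals all_analysis.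
From mathcomp Require Import measurable_realfun.
From mathcomp Require Import ring lra zify.
Import Order.TTheory GRing.Theory Num.Theory.
Import numFieldNormedType.Exports.
Local Open Scope classical_set_scope.
Local Open Scope ring_scope.

(** * The Gamma integral *)

(** The entries of [D] are nonpositive but otherwise arbitrary, so no norm of [w + B] may survive in
    the bounds. It cancels in [Ft^-1 F = A3^-1 A2], and inside [W] it occurs only through the
    contraction [U]. What remains is [|A3^-1|] times twice [|A2^-1| |A2|], which is the shape of
    [xi]: two square roots below, one above.

    The rank is asserted exactly, not bounded. This asks for an invertible [W], hence an invertible
    [R], and for kept corners whose edge diagonal is nonzero. With [M = 2 p], the entry of [T - C]
    at distance [d > p] is [mu * (c_d - c_(M-d))]; both coefficients are negative and [|c_k|] is
    strictly decreasing, so the entry is nonzero and at most [mu * |c_(M-d)|]. The index [m = M - d]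
    therefore measures the size of a diagonal: [m <= k0] is kept in [Mw], and [m > k0] leaves a tail
    of the series of the [|c_k|].

    The comparison with [theta] is delicate: both sides vanish as [alpha] tends to 2, so the sine
    has to be played against the factor [1 - alpha / 2]. *)

Definition gamma_integrand {R : realType} (x t : R) : R := powR t (x - 1) * expR (- t).

(** Kept in the extended reals because the functional equation is proved before finiteness, while
    [fine] would turn an infinite integral into 0. *)
Definition gamma_integral {R : realType} (x : R) : \bar R :=
  (\int[@lebesgue_measure R]_(t in `]0%R, +oo[) (gamma_integrand x t)%:E)%E.

Lemma gamma_integrand_ge0 {R : realType} (x t : R) : 0 <= gamma_integrand x t.
Proof. by rewrite mulr_ge0 ?powR_ge0 ?expR_ge0. Qed.

Lemma measurable_gamma_integrand {R : realType} (D : set R) (x : R) :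
  measurable_fun D (EFin \o gamma_integrand x).
Proof.
apply/measurable_EFinP/measurable_funTS; apply: measurable_funM.
  exact: measurable_powR.
by apply: measurableT_comp => //; exact: measurable_funN.
Qed.

Lemma Gamma_posE {R : realType} (x : R) : Gamma_pos x = fine (gamma_integral x).
Proof.
rewrite /Gamma_pos /gamma_integral integral_itv_obnd_cbnd//.
exact: measurable_gamma_integrand.
Qed.

Lemma gamma_integral_ge0 {R : realType} (x : R) : (0 <= gamma_integral x)%E.
Proof. by apply: integral_ge0 => t _; rewrite lee_fin gamma_integrand_ge0. Qed.

(** The Taylor term [n^(k+1) / (k+1)!] of [expR n], with [k >= x], leaves a quotient of order
    [1 / n]. *)
Lemma powR_expRN_cvg0 {R : realType} (x : R) :
  powR n.+1%:R x * expR (- n.+1%:R) @[n --> \oo] --> (0 : R).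
Proof.
have [k xk] : exists k : nat, x <= k%:R.
  exists (Num.Def.archi_bound `|x|).
  by rewrite ltW// (le_lt_trans (ler_norm x))// archi_boundP.
apply: (@squeeze_cvgr _ _ _ _ (cst 0) (fun n => k.+1`!%:R * n.+1%:R^-1)).
- near=> n; rewrite mulr_ge0 ?powR_ge0 ?expR_ge0//=.
  have n1 : 1 <= n.+1%:R :> R by rewrite ler1n.
  have n0 : 0 < n.+1%:R :> R by rewrite ltr0n.
  have h1 : powR n.+1%:R x <= n.+1%:R ^+ k :> R.
    by rewrite -powR_mulrn// ler_powR.
  have h2 : n.+1%:R ^+ k.+1 / k.+1`!%:R <= expR n.+1%:R :> R.
    rewrite (le_trans _ (@expR_ge1Dxn R n.+1%:R k _))// ?lerDr//.
  have f0 : 0 < k.+1`!%:R :> R by rewrite ltr0n fact_gt0.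
  rewrite expRN ler_pdivrMr ?expR_gt0// (le_trans h1)//.
  rewrite mulrAC ler_pdivlMr// -exprSr mulrC -ler_pdivrMr//.
- exact: cvg_cst.
- rewrite -[X in _ --> X](mulr0 k.+1`!%:R); apply: cvgM; first exact: cvg_cst.
  exact: cvg_harmonic.
Unshelve. all: end_near. Qed.

Lemma powR_expRN_cvg0_right {R : realType} (x : R) : 0 < x ->
  powR n.+1%:R^-1 x * expR (- n.+1%:R^-1) @[n --> \oo] --> (0 : R).
Proof.
move=> x0.
have h : powR t x @[t --> (0:R)^'+] --> (0:R) by exact: powR_cvg0.
move/cvg_at_rightP : h => /(_ (fun n => n.+1%:R^-1)) h.
apply: (@squeeze_cvgr _ _ _ _ (cst 0) (fun n => powR n.+1%:R^-1 x)).
- near=> n; rewrite mulr_ge0 ?powR_ge0 ?expR_ge0//=.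
  by rewrite ler_piMr ?powR_ge0// expR_le1 oppr_le0.
- exact: cvg_cst.
- by apply: h; split; [move=> n; rewrite invr_gt0 ltr0n|exact: cvg_harmonic].
Unshelve. all: end_near. Qed.

Lemma derivable_expRN {R : realType} (t : R) : derivable (fun u => expR (- u)) t 1.
Proof. exact: ex_derive. Qed.

Lemma gamma_integral_by_parts {R : realType} (x a b : R) : 0 < x -> 0 < a -> a < b ->
  (\int[@lebesgue_measure R]_(t in `[a, b]) (gamma_integrand (x + 1) t)%:E =
   (powR a x * expR (- a) - powR b x * expR (- b))%:E +
   x%:E * \int[@lebesgue_measure R]_(t in `[a, b]) (gamma_integrand x t)%:E)%E.
Proof.
move=> x0 a0 ab.
have dpow (y t : R) : t \in `[a, b] -> derivable (powR (R:=R) ^~ y) t 1.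
  by rewrite in_itv/= => /andP[at_ _]; apply: derivable_powR; rewrite in_itv/= andbT (lt_le_trans a0).
have dexp (t : R) : derivable (fun u => - expR (- u)) t 1 by exact: ex_derive.
have cexp : {within `[a, b], continuous (fun t : R => expR (- t))}.
  by apply: derivable_within_continuous => t _; exact: derivable_expRN.
have LR (f : R -> R) : (forall t, t \in `[a, b] -> derivable f t 1) ->
    derivable_oo_LRcontinuous f a b.
  move=> df; split.
  - by move=> t tab; apply: df; exact: subset_itv_oo_cc tab.
  - apply: cvg_at_right_filter; apply: differentiable_continuous.
    by apply/derivable1_diffP/df; rewrite in_itv/= lexx ltW.
  - apply: cvg_at_left_filter; apply: differentiable_continuous.
    by apply/derivable1_diffP/df; rewrite in_itv/= lexx ltW.
have := @integration_by_parts R (powR (R:=R) ^~ x) (fun t => - expR (- t))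
  (fun t => x * powR t (x - 1)) (fun t => expR (- t)) a b ab.
rewrite /gamma_integrand addrK => ->.
- congr (_%:E + _)%E; first by rewrite !mulrN opprK addrC.
  under eq_integral do rewrite mulrN EFinN -mulrA EFinM.
  rewrite integral_ge0N; last first.
    by move=> t _; rewrite -EFinM lee_fin !mulr_ge0 ?powR_ge0 ?expR_ge0// ltW.
  rewrite oppeK ge0_integralZl_EFin//; last exact: ltW.
  + by move=> t _; rewrite lee_fin gamma_integrand_ge0.
  + exact: measurable_gamma_integrand.
- apply: derivable_within_continuous => t tab.
  by apply: derivableM => //; exact: dpow.
- by apply: LR => t tab; exact: dpow.
- by move=> t; rewrite in_itv/= => /andP[at_ _]; apply: powR_derive1; rewrite in_itv/= andbT (lt_trans a0).
- exact: cexp.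
- by apply: LR.
- move=> t _; rewrite derive1E deriveN; last exact: derivable_expRN.
  rewrite -derive1E derive1_comp// derive1N// derive1_id derive1E.
  by have /funeqP -> := @derive_expR R; rewrite mulrN1 opprK.
Qed.

Lemma gamma_integral_succ {R : realType} (x : R) : 0 < x ->
  gamma_integral (x + 1) = (x%:E * gamma_integral x)%E.
Proof.
move=> x0.
(* Exhaustion of the half-line for monotone convergence. Starting at [n.+2] keeps the interval
   nondegenerate at [n = 0], as integration by parts requires. *)
pose A (n : nat) : set R := `[n.+2%:R^-1, n.+2%:R]%classic.
have UA : \bigcup_n A n = `]0, +oo[%classic.
  apply/seteqP; split => [t [n _]|t].
    by rewrite /A/= !in_itv/= => /andP[+ _]; rewrite andbT; apply: lt_le_trans; rewrite invr_gt0.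
  rewrite /= in_itv/= andbT => t0.
  exists (Num.Def.archi_bound (t + t^-1)) => //; rewrite /A/= in_itv/=.
  have ti0 : 0 < t^-1 by rewrite invr_gt0.
  have : t + t^-1 < (Num.Def.archi_bound (t + t^-1))%:R.
    by rewrite archi_boundP// addr_ge0 ?ltW.
  set N := Num.Def.archi_bound _ => tN.
  have NN : N%:R <= N.+2%:R :> R by rewrite ler_nat; lia.
  apply/andP; split; last by lra.
  by rewrite invf_ple ?posrE//; lra.
have ndA : nondecreasing_seq A.
  move=> n m nm; apply/subsetPset => t; rewrite /A/= !in_itv/= => /andP[h1 h2].
  have nm2 : n.+2%:R <= m.+2%:R :> R by rewrite ler_nat.
  by rewrite (le_trans _ h1) ?(le_trans h2)// lef_pV2 ?posrE.
have cv y : (\int[@lebesgue_measure R]_(t in A n) (gamma_integrand y t)%:E)%E @[n --> \oo] -->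
    (\int[@lebesgue_measure R]_(t in \bigcup_n A n) (gamma_integrand y t)%:E)%E.
  apply: ge0_nondecreasing_set_cvg_integral => //.
  - by move=> n; exact: measurable_itv.
  - by move=> n; exact: measurable_gamma_integrand.
  - by move=> n t _; rewrite lee_fin gamma_integrand_ge0.
rewrite /gamma_integral -UA.
pose L (n : nat) : R := powR n.+2%:R^-1 x * expR (- n.+2%:R^-1) - powR n.+2%:R x * expR (- n.+2%:R).
have cL : (L n)%:E @[n --> \oo] --> (0%R)%:E.
  apply: cvg_EFin; first by near=> n.
  rewrite -[X in _ --> X](subr0 0); apply: cvgB.
    by have := powR_expRN_cvg0_right x x0; rewrite -cvg_shiftS.
  by have := powR_expRN_cvg0 x; rewrite -cvg_shiftS.
have /cvg_lim <- // := cv (x + 1).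
apply/cvg_lim => //; rewrite -[X in _ --> X]add0e.
have -> : (fun n => \int[lebesgue_measure]_(t in A n) (gamma_integrand (x + 1) t)%:E)%E =
   (fun n => (L n)%:E + x%:E * \int[lebesgue_measure]_(t in A n) (gamma_integrand x t)%:E)%E.
  apply/funext => n; apply: gamma_integral_by_parts => //.
  by rewrite (@lt_le_trans _ _ 1) ?invf_lt1 ?ltr1n ?ler1n.
by apply: cvgeD => //; apply: cvgeZl => //; exact: cv.
Unshelve. all: end_near. Qed.

Lemma gamma_integral1 {R : realType} : gamma_integral (1 : R) = 1%E.
Proof.
rewrite -(@integral_exponential_pdf R 1 ltr01) /gamma_integral.
rewrite integral_itv_obnd_cbnd; last exact: measurable_gamma_integrand.
rewrite integral_mkcond; apply: eq_integral => t _.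
rewrite /exponential_pdf !patchE; case: ifPn => // _.
by rewrite /gamma_integrand subrr powRr0 !mul1r mulN1r.
Qed.

Lemma gamma_integral_nat_fin {R : realType} (n : nat) :
  gamma_integral (n.+1%:R : R) \is a fin_num.
Proof.
elim: n => [|n ih]; first by rewrite gamma_integral1.
by rewrite -natr1 gamma_integral_succ// fin_numM.
Qed.

(** For [y >= 1] the domination [t^(y-1) <= 1 + t^n] reduces to integer arguments. Below 1 the
    functional equation is read backwards: an infinite value at [x] would be infinite at [x + 1]. *)
Lemma gamma_integral_fin {R : realType} (x : R) : 0 < x ->
  gamma_integral x \is a fin_num.
Proof.
have fin1 (y : R) : 1 <= y -> gamma_integral y \is a fin_num.
  move=> y1; have [n yn] : exists n : nat, y <= n.+1%:R.
    exists (Num.Def.archi_bound y); apply: ltW; rewrite (lt_trans (archi_boundP _)) ?ltr_nat//.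
    by rewrite (le_trans _ y1).
  rewrite ge0_fin_numE ?gamma_integral_ge0//.
  apply: (@le_lt_trans _ _ (gamma_integral 1 + gamma_integral n.+1%:R)%E); last first.
    by rewrite gamma_integral1 lte_add_pinfty// ?ltry// ltey_eq gamma_integral_nat_fin.
  rewrite /gamma_integral -ge0_integralD//=; last 4 first.
  - by move=> t _; rewrite lee_fin gamma_integrand_ge0.
  - exact: measurable_gamma_integrand.
  - by move=> t _; rewrite lee_fin gamma_integrand_ge0.
  - exact: measurable_gamma_integrand.
  apply: ge0_le_integral => //=.
  - by move=> t _; rewrite lee_fin gamma_integrand_ge0.
  - exact: measurable_gamma_integrand.
  - by apply: emeasurable_funD; exact: measurable_gamma_integrand.
  - move=> t; rewrite in_itv/= andbT => t0.
    rewrite -EFinD lee_fin /gamma_integrand -mulrDl ler_wpM2r ?expR_ge0//.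
    rewrite subrr powRr0; have [t1|t1] := leP t 1.
      rewrite (@le_trans _ _ 1) ?lerDl ?powR_ge0//.
      by rewrite -[leRHS](powRr0 t) ger_powR ?subr_ge0// t0.
    rewrite (@le_trans _ _ (powR t (n.+1%:R - 1))) ?lerDr//.
    by rewrite ler_powR ?lerD2r// ltW.
move=> x0; have := fin1 (x + 1); rewrite lerDr gamma_integral_succ// => /(_ (ltW x0)).
rewrite !ge0_fin_numE ?gamma_integral_ge0//; last first.
  by rewrite mule_ge0 ?gamma_integral_ge0// lee_fin ltW.
case: (gamma_integral x) (gamma_integral_ge0 x) => [r _ _|_|//]; first exact: ltry.
by rewrite gt0_muley ?lte_fin.
Qed.

Lemma Gamma_posEfin {R : realType} (x : R) : 0 < x ->
  (Gamma_pos x)%:E = gamma_integral x.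
Proof. by move=> x0; rewrite Gamma_posE fineK// gamma_integral_fin. Qed.

Lemma Gamma_pos_succ {R : realType} (x : R) : 0 < x ->
  Gamma_pos (x + 1) = x * Gamma_pos x.
Proof.
by move=> x0; rewrite !Gamma_posE gamma_integral_succ// fineM// gamma_integral_fin.
Qed.

Lemma Gamma_pos1 {R : realType} : Gamma_pos (1 : R) = 1.
Proof. by rewrite Gamma_posE gamma_integral1. Qed.

(** Young's inequality for the product of [t^s] and 1 with exponents [1 / s] and [1 / (1 - s)]; at
    the endpoints one exponent degenerates. *)
Lemma powR_le_linear {R : realType} (s t : R) : 0 <= s -> s <= 1 -> 0 < t ->
  powR t s <= 1 - s + s * t.
Proof.
move=> s0 s1 t0; have [->|sN0] := eqVneq s 0.
  by rewrite powRr0 mul0r addr0 subr0.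
have [->|sN1] := eqVneq s 1; first by rewrite powRr1 ?(ltW t0)// subrr add0r mul1r.
have s0' : 0 < s by rewrite lt_neqAle eq_sym sN0.
have s1' : 0 < 1 - s by rewrite subr_gt0 lt_neqAle sN1.
have := @conjugate_powR R (powR t s) 1 s^-1 (1 - s)^-1 (powR_ge0 _ _) ler01.
rewrite !invr_gt0 => /(_ s0' s1'); rewrite !invrK.
have e1 : s + (1 - s) = 1 by lra.
move=> /(_ e1); rewrite -powRrM mulfV// powRr1 ?(ltW t0)// powR1 mulr1; lra.
Qed.

(* Bernoulli's inequality [(t / x)^s <= 1 - s + s * (t / x)], integrated against
   the Gamma density. *)
Lemma Gamma_pos_le {R : realType} (x s : R) : 0 < x -> 0 <= s -> s <= 1 ->
  Gamma_pos (x + s) <= powR x s * Gamma_pos x.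
Proof.
move=> x0 s0 s1.
have xs0 : 0 < x + s by rewrite ltr_wpDr.
have x10 : 0 < x + 1 by rewrite ltr_wpDr.
have s10 : 0 <= 1 - s by rewrite subr_ge0.
(* The functional equation collapses the right side to [x^s * ((1 - s) + s) * Gamma_pos x]. *)
suff : ((Gamma_pos (x + s))%:E <=
    (powR x s * (1 - s))%:E * (Gamma_pos x)%:E +
    (powR x s * s / x)%:E * (Gamma_pos (x + 1))%:E)%E.
  rewrite -!EFinM -EFinD lee_fin Gamma_pos_succ// => /le_trans; apply.
  rewrite le_eqVlt; apply/orP; left; apply/eqP; field; lra.
have c1 : 0 <= powR x s * (1 - s) by rewrite mulr_ge0 ?powR_ge0.
have c2 : 0 <= powR x s * s / x by rewrite !mulr_ge0 ?powR_ge0// invr_ge0 ltW.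
rewrite !Gamma_posEfin// /gamma_integral.
rewrite -!ge0_integralZl_EFin//; last 4 first.
- by move=> t _; rewrite lee_fin gamma_integrand_ge0.
- exact: measurable_gamma_integrand.
- by move=> t _; rewrite lee_fin gamma_integrand_ge0.
- exact: measurable_gamma_integrand.
have mZ (c y : R) : measurable_fun (`]0, +oo[%classic : set R) (fun t : R => c%:E * (gamma_integrand y t)%:E)%E.
  by apply: emeasurable_funM => //; exact: measurable_gamma_integrand.
rewrite -ge0_integralD//=; last 4 first.
- by move=> t _; rewrite mule_ge0// lee_fin gamma_integrand_ge0.
- exact: mZ.
- by move=> t _; rewrite mule_ge0// lee_fin gamma_integrand_ge0.
- exact: mZ.
apply: ge0_le_integral => //=.
- by move=> t _; rewrite lee_fin gamma_integrand_ge0.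
- exact: measurable_gamma_integrand.
- by apply: emeasurable_funD; exact: mZ.
move=> t; rewrite in_itv/= andbT => t0.
rewrite -!EFinM -EFinD lee_fin /gamma_integrand.
have tN0 : t != 0 by rewrite gt_eqF.
have -> : powR t (x + s - 1) = powR t s * powR t (x - 1).
  by rewrite -powRD ?tN0 ?implybT//; congr powR; lra.
have -> : powR t (x + 1 - 1) = t * powR t (x - 1) by rewrite mulr_powRB1 ?addrK// ltW.
have -> : powR t s = powR x s * powR (t / x) s.
  rewrite -powRM ?(ltW x0)// ?divr_ge0 ?ltW//.
  by rewrite mulrCA mulfV ?mulr1// gt_eqF.
have p0 : 0 <= powR t (x - 1) * expR (- t) by rewrite mulr_ge0 ?powR_ge0 ?expR_ge0.
have := @powR_le_linear R s (t / x) s0 s1 (divr_gt0 t0 x0).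
move=> /(ler_wpM2l (powR_ge0 x s)) /(ler_wpM2r p0).
rewrite !mulrA => /le_trans; apply; rewrite le_eqVlt; apply/orP; left; apply/eqP; field; lra.
Qed.

(** [Gamma_pos_le] with the step [n + 1 - x] bounds a positive integer value by a multiple of
    [Gamma_pos x], which therefore cannot vanish. *)
Lemma Gamma_pos_gt0 {R : realType} (x : R) : 0 < x -> 0 < Gamma_pos x.
Proof.
have ge0 (y : R) : 0 <= Gamma_pos y.
  by rewrite Gamma_posE fine_ge0// gamma_integral_ge0.
have nat0 (n : nat) : 0 < Gamma_pos (n.+1%:R : R).
  elim: n => [|n ih]; first by rewrite Gamma_pos1.
  by rewrite -natr1 Gamma_pos_succ// mulr_gt0.
move=> x0.
pose n := Num.truncn x.
have [nx xn] : n%:R <= x /\ x < n.+1%:R by apply/andP; apply: truncn_itv; exact: ltW.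
have xn1 : 0 <= n.+1%:R - x by rewrite subr_ge0 ltW.
have := @Gamma_pos_le R x (n.+1%:R - x) x0 xn1.
rewrite -natr1 => /(_ _); rewrite (addrC x) subrK.
have h1 : n%:R + 1 - x <= 1 by lra.
move=> /(_ h1); rewrite natr1 => h.
rewrite lt_neqAle ge0 andbT; apply/eqP => G0.
by have := nat0 n; rewrite ltNge (le_trans h)// -G0 mulr0.
Qed.

(** * Elementary estimates *)

Lemma ge0_of_derive_ge0 {R : realType} (f df : R -> R) (x : R) : 0 <= x -> f 0 = 0 ->
  (forall t, 0 <= t -> t <= x -> is_derive t 1 f (df t)) ->
  (forall t, 0 <= t -> t <= x -> 0 <= df t) -> 0 <= f x.
Proof.
move=> x0 f0 dfE df0.
have cf : {within `[0, x], continuous f}.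
  apply: derivable_within_continuous => t; rewrite in_itv/= => /andP[h1 h2].
  by have [] := dfE t h1 h2.
have [t|c cx] := @MVT_segment R f df 0 x x0 _ cf.
  by rewrite in_itv/= => /andP[h1 h2]; apply: dfE; exact: ltW.
move: cx; rewrite in_itv/= => /andP[h1 h2].
by rewrite f0 !subr0 => ->; rewrite mulr_ge0// df0.
Qed.

Lemma sin_le_id {R : realType} (x : R) : 0 <= x -> sin x <= x.
Proof.
move=> x0; rewrite -subr_ge0.
apply: (@ge0_of_derive_ge0 R (fun t => t - sin t) (fun t => 1 - cos t) x x0).
- by rewrite sin0 subr0.
- by move=> t _ _; rewrite subr_ge0 cos_le1.
Qed.

Lemma mulr_cos_le_sin {R : realType} (x : R) : 0 <= x -> x <= pi -> x * cos x <= sin x.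
Proof.
move=> x0 xpi; rewrite -subr_ge0.
apply: (@ge0_of_derive_ge0 R (fun t => sin t - t * cos t) (fun t => t * sin t) x x0).
- by rewrite sin0 mul0r subr0.
- move=> t _ _; apply: is_derive_eq; rewrite /GRing.scale/=; ring.
- by move=> t t0 tx; rewrite mulr_ge0// sin_ge0_pi// t0 (le_trans tx).
Qed.

(** Half angles: [sin x = 2 sin (x/2) cos (x/2) >= x cos (x/2)^2], and [cos x >= 0] means
    [cos (x/2)^2 >= 1/2]. *)
Lemma half_le_sin {R : realType} (x : R) : 0 <= x -> x <= pi / 2 -> x / 2 <= sin x.
Proof.
move=> x0 xpi; have pi0 := @pi_gt0 R.
have h := @mulr_cos_le_sin R (x / 2) _ _.
have {}h : x / 2 * cos (x / 2) <= sin (x / 2) by apply: h; lra.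
have c0 : 0 <= cos (x / 2) by apply: cos_ge0_pihalf; lra.
have c1 : 0 <= cos x by apply: cos_ge0_pihalf; lra.
have e : x = (x / 2) *+ 2 by rewrite mulr2n; lra.
move: c1; rewrite {1}e cos_mulr2n mulr2n => c1.
rewrite [X in _ <= sin X]e sin_mulr2n [in leRHS]mulr2n.
have h2 := ler_wpM2r c0 h.
have c2 : 1 / 2 <= cos (x / 2) ^+ 2 by lra.
have h3 : x / 2 * (1 / 2) <= x / 2 * cos (x / 2) ^+ 2 by rewrite ler_wpM2l//; lra.
lra.
Qed.

(** The triple-angle formula at [pi / 6] reads [(2 s - 1)^2 (s + 1) = 0] for [s = sin (pi / 6)];
    hence [1 / 2 = s <= pi / 6]. *)
Lemma pi_ge3 {R : realType} : 3 <= pi :> R.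
Proof.
have pi0 := @pi_gt0 R.
pose s : R := sin (pi / 6).
have e : pi / 2 = pi / 6 *+ 2 + pi / 6 :> R by lra.
have s0 : 0 < s by apply: sin_gt0_pi; lra.
have := @sin_pihalf R; rewrite e sinD sin_mulr2n cos_mulr2n.
have c2 := cos2sin2 (pi / 6 : R).
have -> : cos (pi / 6) * sin (pi / 6) *+ 2 * cos (pi / 6) +
   (cos (pi / 6) ^+ 2 *+ 2 - 1) * sin (pi / 6) = (4 * cos (pi / 6) ^+ 2 - 1) * s.
  by rewrite -/s; ring.
rewrite c2 -/s => h.
have /eqP : (2 * s - 1) ^+ 2 * (s + 1) = 0 by lra.
rewrite mulf_eq0 sqrf_eq0 => /orP[/eqP h1|/eqP h1]; last by lra.
have := @sin_le_id R (pi / 6) _; rewrite -/s => h2.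
have : s <= pi / 6 by apply: h2; lra.
lra.
Qed.

(** Supplies rational lower bounds of [expR] that [lra] can check. *)
Lemma expR_ge_expr {R : realType} (x : R) (n : nat) : 0 <= x ->
  (1 + x / n.+1%:R) ^+ n.+1 <= expR x.
Proof.
move=> x0; have -> : x = x / n.+1%:R * n.+1%:R by rewrite divfK.
rewrite expRM_natr divfK// lerXn2r ?nnegrE ?expR_ge0 ?expR_ge1Dx//.
by rewrite addr_ge0// divr_ge0.
Qed.

Lemma ln1B_le {R : realType} (z : R) : 0 <= z -> z < 1 ->
  ln (1 - z) <= - z - z ^+ 2 / 2 - z ^+ 3 / 3.
Proof.
move=> z0 z1; rewrite -subr_ge0.
have := @ge0_of_derive_ge0 R (fun t => - t - t ^+ 2 / 2 - t ^+ 3 / 3 - ln (1 - t))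
  (fun t => - 1 - t - t ^+ 2 + (1 - t)^-1) z z0; apply.
- by rewrite !expr0n/= subr0 ln1; ring.
- move=> t t0 tz; have t1 : 0 < 1 - t by lra.
  have dl := is_derive1_ln t1.
  have d1 : is_derive t 1 (fun t : R => 1 - t) (-1).
    by apply: is_derive_eq; ring.
  have d2 : is_derive t 1 (fun t : R => ln (1 - t)) (- (1 - t)^-1).
    have d3 := @is_derive1_comp R (@ln R) (fun u : R => 1 - u) t _ _ dl d1.
    by apply: (is_derive_eq d3); rewrite /GRing.scale/= mulrN1.
  apply: is_derive_eq; rewrite /GRing.scale/= !mulr2n.
  by field; rewrite gt_eqF.
- move=> t t0 tz; have t1 : 0 < 1 - t by lra.
  suff -> : - 1 - t - t ^+ 2 + (1 - t)^-1 = t ^+ 3 / (1 - t).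
    by rewrite divr_ge0 ?exprn_ge0 ?(ltW t1).
  by field; rewrite gt_eqF.
Qed.

(** The part of [theta] free of Gamma and sine. In [(1 - y/x)^x * e^y] the exponential cancels the
    leading term [- y] of [x * ln (1 - y/x)], so the quadratic and cubic terms govern its size. *)
Definition theta_factor {R : realType} (alpha : R) : R :=
  powR (1 - (1 + alpha) / (5 + alpha / 2)) (5 + alpha / 2) * expR (1 + alpha).

Lemma theta_factor_le {R : realType} (alpha q : R) : 1 <= alpha -> alpha <= 2 ->
  q <= (1 + alpha) ^+ 2 / (2 * (5 + alpha / 2)) + (1 + alpha) ^+ 3 / (3 * (5 + alpha / 2) ^+ 2) ->
  theta_factor alpha <= expR (- q).
Proof.
move=> a1 a2 hq; rewrite /theta_factor.
set y := 1 + alpha in hq *; set x := 5 + alpha / 2 in hq *.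
have y0 : 0 < y by rewrite /y; lra.
have x0 : 0 < x by rewrite /x; lra.
have z1 : y / x < 1 by rewrite ltr_pdivrMr// /y /x; lra.
have z0 : 0 <= y / x by rewrite divr_ge0 ?ltW.
have w0 : 0 < 1 - y / x by lra.
rewrite /powR gt_eqF// -expRD ler_expR.
have := ler_wpM2l (ltW x0) (ln1B_le (y / x) z0 z1).
have -> : x * (- (y / x) - (y / x) ^+ 2 / 2 - (y / x) ^+ 3 / 3) =
   - y - (y ^+ 2 / (2 * x) + y ^+ 3 / (3 * x ^+ 2)).
  by field; rewrite gt_eqF.
by move=> h; lra.
Qed.

Lemma theta_factor_ge0 {R : realType} (alpha : R) : 0 <= theta_factor alpha.
Proof. by rewrite mulr_ge0 ?powR_ge0 ?expR_ge0. Qed.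

(** The split at [31 / 25] is made for [theta_factor_sin_le]: at that point each of its two cases
    has a margin below two percent. *)
Lemma theta_factor_le1 {R : realType} (alpha : R) : 1 <= alpha -> alpha <= 31 / 25 ->
  theta_factor alpha <= 16 / 25.
Proof.
move=> a1 a2.
have h : theta_factor alpha <= expR (- (9 / 20)).
  apply: theta_factor_le => //; first lra.
  have x0 : 0 < 5 + alpha / 2 by lra.
  (* Both terms increase with [alpha]; these are their values at [alpha = 1]. *)
  have h1 : 4 / 11 <= (1 + alpha) ^+ 2 / (2 * (5 + alpha / 2)).
    by rewrite ler_pdivlMr; [nra|lra].
  have h2 : 8 / (363 / 4) <= (1 + alpha) ^+ 3 / (3 * (5 + alpha / 2) ^+ 2).
    rewrite ler_pdivlMr; last by rewrite mulr_gt0 ?exprn_gt0.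
    nra.
  lra.
apply: (le_trans h); rewrite expRN -[leRHS]invrK lef_pV2 ?posrE ?expR_gt0 ?invr_gt0//.
apply: le_trans (@expR_ge_expr R (9 / 20) 39 _); last lra.
lra.
Qed.

Lemma theta_factor_le2 {R : realType} (alpha : R) : 31 / 25 <= alpha -> alpha <= 2 ->
  theta_factor alpha <= 57 / 100.
Proof.
move=> a1 a2.
have h : theta_factor alpha <= expR (- (113 / 200)).
  apply: theta_factor_le => //; first lra.
  have x0 : 0 < 5 + alpha / 2 by lra.
  (* The values at [alpha = 31 / 25], rounded down; they add up to [113 / 200]. *)
  have h1 : 4464 / 10000 <= (1 + alpha) ^+ 2 / (2 * (5 + alpha / 2)).
    by rewrite ler_pdivlMr; [nra|lra].
  have h2 : 1186 / 10000 <= (1 + alpha) ^+ 3 / (3 * (5 + alpha / 2) ^+ 2).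
    rewrite ler_pdivlMr; last by rewrite mulr_gt0 ?exprn_gt0.
    nra.
  lra.
apply: (le_trans h); rewrite expRN -[leRHS]invrK lef_pV2 ?posrE ?expR_gt0 ?invr_gt0//.
apply: le_trans (@expR_ge_expr R (113 / 200) 60 _); last lra.
lra.
Qed.

(** * The coefficients [c_k] *)

Lemma Gamma_gt0E {R : realType} (x : R) : 0 < x -> Gamma x = Gamma_pos x.
Proof. by move=> x0; rewrite /Gamma /Gamma_shift x0 addr0 big_ord0 divr1. Qed.

Lemma Gamma_gt0 {R : realType} (x : R) : 0 < x -> 0 < Gamma x.
Proof. by move=> x0; rewrite Gamma_gt0E ?Gamma_pos_gt0. Qed.

Lemma Gamma_succ {R : realType} (x : R) : 0 < x -> Gamma (x + 1) = x * Gamma x.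
Proof. by move=> x0; rewrite !Gamma_gt0E ?Gamma_pos_succ// ltr_wpDr. Qed.

Lemma Gamma1 {R : realType} : Gamma (1 : R) = 1.
Proof. by rewrite Gamma_gt0E ?Gamma_pos1. Qed.

Lemma Gamma_le {R : realType} (x s : R) : 0 < x -> 0 <= s -> s <= 1 ->
  Gamma (x + s) <= powR x s * Gamma x.
Proof. by move=> x0 s0 s1; rewrite !Gamma_gt0E ?Gamma_pos_le// ltr_wpDr. Qed.

(** True at the poles as well, thanks to [0^-1 = 0]. For [x <= -1] the shift of [x] exceeds that of
    [x + 1] by one, and the extra factor is [x]. This identity alone yields the recurrence of the
    coefficients. *)
Lemma rGamma_succ {R : realType} (x : R) : rGamma x = x * rGamma (x + 1).
Proof.
have [x0|x0] := ltP 0 x.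
  rewrite /rGamma Gamma_succ//; field.
  by rewrite !gt_eqF// Gamma_gt0.
have [x1|x1] := ltP 0 (x + 1).
  have -> : rGamma x = (Gamma_pos (x + 1) / x)^-1.
    rewrite /rGamma /Gamma /Gamma_shift ltNge x0/=.
    have -> : Num.floor (- x) = 0 by apply: floor_def; rewrite add0r; apply/andP; split; lra.
    by rewrite big_ord1 addr0.
  by rewrite /rGamma Gamma_gt0E// invf_div.
rewrite /rGamma.
have e : Gamma_shift x = (Gamma_shift (x + 1)).+1.
  rewrite /Gamma_shift !ltNge x0 x1/=.
  have : Num.floor (- x) = Num.floor (- (x + 1)) + 1.
    have -> : - x = - (x + 1) + 1 by lra.
    by rewrite floorDrz ?rpred1// floor1.
  have : 0 <= Num.floor (- (x + 1)) by rewrite floor_ge0; lra.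
  lia.
rewrite /Gamma e big_ord_recl addr0 -natr1 addrA addrAC !invf_div.
rewrite mulrA; congr (_ * _ / Gamma_pos _).
by apply: eq_bigr => i _; rewrite lift0 -natr1 addrA addrAC.
Qed.

Lemma coefN {R : realType} (alpha : R) (k : int) : coef alpha (- k) = coef alpha k.
Proof.
rewrite /coef abszN rmorphN/= opprK; ring.
Qed.

Lemma coef_succ {R : realType} (alpha : R) (k : nat) : 0 < alpha ->
  (alpha / 2 + k%:R + 1) * coef alpha k.+1%:Z = (k%:R - alpha / 2) * coef alpha k%:Z.
Proof.
move=> a0; rewrite /coef !absz_nat exprS -!pmulrn.
have -> : alpha / 2 - k.+1%:R + 1 = alpha / 2 - k%:R :> R by rewrite -natr1; lra.
rewrite (rGamma_succ (alpha / 2 - k%:R)).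
rewrite (rGamma_succ (alpha / 2 + k%:R + 1)) -(natr1 k).
have -> : alpha / 2 + (k%:R + 1) + 1 = alpha / 2 + k%:R + 1 + 1 by lra.
ring.
Qed.

Lemma coef0E {R : realType} (alpha : R) :
  coef alpha 0 = Gamma (alpha + 1) / Gamma (alpha / 2 + 1) ^+ 2.
Proof.
by rewrite /coef/= expr0 mul1r subr0 addr0 /rGamma -mulrA -invfM expr2.
Qed.

Lemma coef0_gt0 {R : realType} (alpha : R) : 0 < alpha -> 0 < coef alpha 0.
Proof.
by move=> a0; rewrite coef0E divr_gt0 ?exprn_gt0 ?Gamma_gt0//; lra.
Qed.

(** The sign flips once, from [c_0] to [c_1]; afterwards the recurrence has the factor
    [k - alpha / 2], positive since [alpha / 2 < 1 <= k]. *)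
Lemma coef_lt0 {R : realType} (alpha : R) (k : nat) : 0 < alpha -> alpha < 2 ->
  coef alpha k.+1%:Z < 0.
Proof.
move=> a0 a2; elim: k => [|k ih].
  have h : (alpha / 2 + 1) * coef alpha 1%:Z = - (alpha / 2) * coef alpha 0.
    by have := coef_succ alpha 0 a0; rewrite addr0 sub0r.
  have c0 := coef0_gt0 alpha a0.
  suff : (alpha / 2 + 1) * coef alpha 1%:Z < 0 by rewrite pmulr_rlt0//; lra.
  by rewrite h mulNr oppr_lt0 mulr_gt0//; lra.
have := coef_succ alpha k.+1 a0 => h.
have k1 : 1 <= k.+1%:R :> R by rewrite ler1n.
rewrite -(@pmulr_rlt0 _ (alpha / 2 + k.+1%:R + 1)) ?h; last lra.
by rewrite pmulr_rlt0//; lra.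
Qed.

(* The tail [\sum_(k >= m) |c_k|], which telescopes to a closed form. *)
Definition coef_tail {R : realType} (alpha : R) (m : nat) : R :=
  (m%:R + alpha / 2) * `|coef alpha m%:Z| / alpha.

Lemma coef_abs_succ {R : realType} (alpha : R) (k : nat) : 0 < alpha -> alpha < 2 ->
  (alpha / 2 + k.+1%:R + 1) * `|coef alpha k.+2%:Z| =
  (k.+1%:R - alpha / 2) * `|coef alpha k.+1%:Z|.
Proof.
move=> a0 a2; rewrite !ltr0_norm ?coef_lt0// !mulrN; congr (- _).
exact: coef_succ.
Qed.

(** By the recurrence the difference is [((k + s) - (k - s)) * |c_k| / alpha] with [k = m + 1] and
    [2 s = alpha]. *)
Lemma coef_tailB {R : realType} (alpha : R) (m : nat) : 0 < alpha -> alpha < 2 ->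
  coef_tail alpha m.+1 - coef_tail alpha m.+2 = `|coef alpha m.+1%:Z|.
Proof.
move=> a0 a2; rewrite /coef_tail.
have -> : m.+2%:R + alpha / 2 = alpha / 2 + m.+1%:R + 1 :> R by rewrite -(natr1 m.+1); lra.
rewrite coef_abs_succ//; field; lra.
Qed.

(** Equivalently, the [c_k] sum to 0 over all integers: the diagonal dominance of a finite section
    is exactly what its missing tails provide. *)
Lemma coef_tail1 {R : realType} (alpha : R) : 0 < alpha -> alpha < 2 ->
  coef_tail alpha 1 = coef alpha 0 / 2.
Proof.
move=> a0 a2; rewrite /coef_tail ltr0_norm ?coef_lt0//.
have := coef_succ alpha 0 a0; rewrite addr0 sub0r => h.
rewrite mulrN (addrC 1) h; field; lra.
Qed.

Lemma sum_coef {R : realType} (alpha : R) (m n : nat) : 0 < alpha -> alpha < 2 ->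
  (m <= n)%N -> \sum_(m.+1 <= k < n.+1) `|coef alpha k%:Z| =
  coef_tail alpha m.+1 - coef_tail alpha n.+1.
Proof.
move=> a0 a2; elim: n => [|n ih].
  by rewrite leqn0 => /eqP ->; rewrite big_geq// subrr.
rewrite leq_eqVlt => /orP[/eqP ->|]; first by rewrite big_geq// subrr.
by rewrite ltnS => mn; rewrite big_nat_recr ?ltnS//= ih// -(coef_tailB alpha n)//; ring.
Qed.

Lemma coef_tail_ge0 {R : realType} (alpha : R) (m : nat) : 0 < alpha ->
  0 <= coef_tail alpha m.
Proof.
by move=> a0; rewrite /coef_tail !mulr_ge0 ?invr_ge0 ?addr_ge0 ?divr_ge0//; lra.
Qed.

Lemma coef_abs_gt0 {R : realType} (alpha : R) (m : nat) : 0 < alpha -> alpha < 2 ->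
  0 < `|coef alpha m.+1%:Z|.
Proof. by move=> a0 a2; rewrite normr_gt0 lt_eqF// coef_lt0. Qed.

Lemma coef_abs_decr {R : realType} (alpha : R) (m n : nat) : 0 < alpha -> alpha < 2 ->
  (m < n)%N -> `|coef alpha n.+1%:Z| < `|coef alpha m.+1%:Z|.
Proof.
move=> a0 a2; have step k : `|coef alpha k.+2%:Z| < `|coef alpha k.+1%:Z|.
  have h := coef_abs_succ alpha k a0 a2.
  have c0 := coef_abs_gt0 alpha k a0 a2.
  have k1 : 0 <= k.+1%:R :> R by [].
  rewrite -(@ltr_pM2l _ (alpha / 2 + k.+1%:R + 1)) ?h; last lra.
  by rewrite ltr_pM2r//; lra.
elim: n => [//|n ih]; rewrite ltnS leq_eqVlt => /orP[/eqP ->//|mn].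
exact: (lt_trans (step n)) (ih mn).
Qed.

(** Passing from [k] to [k + 1] multiplies both sides by [(k - s) / (k + s)], [s = alpha / 2].
    Writing [1 / Gamma (1 - s)] as [(1 - s) / Gamma (2 - s)] isolates the factor that vanishes at
    [alpha = 2], to be matched with the sine. *)
Lemma coef_tailE {R : realType} (alpha : R) (m : nat) : 0 < alpha -> alpha < 2 ->
  coef_tail alpha m.+1 =
  Gamma (alpha + 1) * (1 - alpha / 2) /
    (2 * (Gamma (1 + alpha / 2) * Gamma (2 - alpha / 2))) *
  (Gamma (m.+1%:R - alpha / 2) / Gamma (m.+1%:R + alpha / 2)).
Proof.
move=> a0 a2.
have G1 : Gamma (alpha / 2 + 1) != 0 by rewrite gt_eqF// Gamma_gt0//; lra.
have s1 : 0 < 1 - alpha / 2 by lra.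
have G2 : Gamma (1 - alpha / 2) != 0 by rewrite gt_eqF// Gamma_gt0//; lra.
have -> : 2 - alpha / 2 = 1 - alpha / 2 + 1 by lra.
rewrite (Gamma_succ (1 - alpha / 2))//.
elim: m => [|m ih].
  rewrite coef_tail1// coef0E (addrC (alpha / 2) 1) !mulr1n; field.
  by rewrite (addrC 1) G1 G2; lra.
have m1 : 1 <= m.+1%:R :> R by rewrite ler1n.
have G3 : Gamma (m.+1%:R - alpha / 2) != 0 by rewrite gt_eqF// Gamma_gt0//; lra.
have G4 : Gamma (m.+1%:R + alpha / 2) != 0 by rewrite gt_eqF// Gamma_gt0//; lra.
have -> : coef_tail alpha m.+2 = (m.+1%:R - alpha / 2) / (m.+1%:R + alpha / 2) * coef_tail alpha m.+1.
  rewrite /coef_tail.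
  have -> : m.+2%:R + alpha / 2 = alpha / 2 + m.+1%:R + 1 :> R by rewrite -(natr1 m.+1); lra.
  rewrite coef_abs_succ//; field; lra.
rewrite ih -(natr1 m.+1).
have -> : m.+1%:R + 1 - alpha / 2 = m.+1%:R - alpha / 2 + 1 by lra.
have -> : m.+1%:R + 1 + alpha / 2 = m.+1%:R + alpha / 2 + 1 by lra.
rewrite (Gamma_succ (m.+1%:R - alpha / 2)); last lra.
rewrite (Gamma_succ (m.+1%:R + alpha / 2)); last lra.
have G5 : Gamma (1 + alpha / 2) != 0 by rewrite addrC.
by field; rewrite G2 G4 G5; lra.
Qed.

Lemma sin_pi_half_alpha {R : realType} (alpha : R) :
  sin (pi * alpha / 2) = sin (pi * (1 - alpha / 2)).
Proof.
have -> : pi * (1 - alpha / 2) = - (pi * alpha / 2) + pi by ring.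
by rewrite sinDpi sinN opprK.
Qed.

(* Below [31 / 25] it is enough that [sin <= 1]; above, the factor is small enough
   for [sin (pi * (1 - alpha / 2)) <= pi * (1 - alpha / 2)]. The base [16 / 15] is
   [8 / (8 - 1 / 2)], the worst case of [M / (M - 1 / 2)]. *)
Lemma theta_factor_sin_le {R : realType} (alpha : R) : 1 < alpha -> alpha < 2 ->
  theta_factor alpha * sin (pi * alpha / 2) * powR (16 / 15) alpha <=
  pi * (alpha / 2) * (1 - alpha / 2).
Proof.
move=> a1 a2.
have p3 := @pi_ge3 R; have pi0 := @pi_gt0 R.
(* One factor [16 / 15] is split off so that the remaining exponent [alpha - 1] lies in the range of
   Bernoulli's inequality. *)
have hr : powR (16 / 15 : R) alpha <= 16 / 15 * (1 + (alpha - 1) / 15).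
  rewrite -(mulr_powRB1 (x := 16 / 15)); try lra.
  rewrite ler_wpM2l//.
  have h := @powR_le_linear R (alpha - 1) (16 / 15).
  have {}h : powR (16 / 15 : R) (alpha - 1) <= 1 - (alpha - 1) + (alpha - 1) * (16 / 15).
    by apply: h; lra.
  lra.
have r0 := powR_ge0 (16 / 15 : R) alpha.
have K0 := theta_factor_ge0 alpha.
have s1 := sin_le1 (pi * alpha / 2).
have s0 : 0 <= sin (pi * alpha / 2).
  by apply: sin_ge0_pi; apply/andP; split; nra.
have [a3|a3] := leP alpha (31 / 25).
  have hK := theta_factor_le1 alpha (ltW a1) a3.
  have h1 : theta_factor alpha * sin (pi * alpha / 2) <= 16 / 25 * 1 by rewrite ler_pM.
  have h2 : theta_factor alpha * sin (pi * alpha / 2) * powR (16 / 15) alpha <=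
      16 / 25 * 1 * (16 / 15 * (1 + (alpha - 1) / 15)).
    by rewrite ler_pM// mulr_ge0.
  have h3 : 3 * ((alpha / 2) * (1 - alpha / 2)) <= pi * ((alpha / 2) * (1 - alpha / 2)).
    by rewrite ler_wpM2r// mulr_ge0; lra.
  nra.
have hK := theta_factor_le2 alpha (ltW a3) (ltW a2).
have hs : sin (pi * alpha / 2) <= pi * (1 - alpha / 2).
  by rewrite sin_pi_half_alpha sin_le_id// mulr_ge0; lra.
have h1 : theta_factor alpha * powR (16 / 15) alpha <= 57 / 100 * (16 / 15 * (1 + (alpha - 1) / 15)).
  by rewrite ler_pM.
have h2 : theta_factor alpha * powR (16 / 15) alpha <= alpha / 2 by lra.
have h3 : theta_factor alpha * powR (16 / 15) alpha * sin (pi * alpha / 2) <=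
    alpha / 2 * (pi * (1 - alpha / 2)).
  by rewrite ler_pM// mulr_ge0.
lra.
Qed.

(** * Gamma quotients and the two bounds on the tails *)

Lemma Gamma_prod_le1 {R : realType} (s : R) : 0 <= s -> s <= 1 ->
  Gamma (1 + s) * Gamma (2 - s) <= 1.
Proof.
move=> s0 s1.
have h1 : Gamma (1 + s) <= 1.
  by have := Gamma_le 1 s ltr01 s0 s1; rewrite powR1 Gamma1 mulr1.
have h2 : Gamma (2 - s) <= 1.
  have -> : 2 - s = 1 + (1 - s) by lra.
  have := @Gamma_le R 1 (1 - s) ltr01; rewrite powR1 Gamma1 mulr1; apply; lra.
rewrite -[leRHS]mulr1 ler_pM// ltW// Gamma_gt0//; lra.
Qed.

(** Reaching [Gamma 2 = 1] from [1 + s] and from [2 - s] costs a factor at most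
    [1 + s (1 - s) <= 5 / 4] each time, so the product is at least [16 / 25]. *)
Lemma Gamma_prod_ge_half {R : realType} (s : R) : 0 <= s -> s <= 1 ->
  1 / 2 <= Gamma (1 + s) * Gamma (2 - s).
Proof.
move=> s0 s1.
have G2 : Gamma (2 : R) = 1.
  by have := @Gamma_succ R 1 ltr01; rewrite Gamma1 mulr1.
have g1 : 0 < Gamma (1 + s) by apply: Gamma_gt0; lra.
have g2 : 0 < Gamma (2 - s) by apply: Gamma_gt0; lra.
have h1 : 1 <= (1 + s * (1 - s)) * Gamma (1 + s).
  have := @Gamma_le R (1 + s) (1 - s).
  have -> : 1 + s + (1 - s) = 2 by lra.
  rewrite G2 => h.
  have {}h : 1 <= powR (1 + s) (1 - s) * Gamma (1 + s) by apply: h; lra.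
  apply: (le_trans h); rewrite ler_pM2r//.
  by apply: le_trans (powR_le_linear (1 - s) (1 + s) _ _ _) _; lra.
have h2 : 1 <= (1 + s * (1 - s)) * Gamma (2 - s).
  have := @Gamma_le R (2 - s) s; rewrite subrK G2 => h.
  have {}h : 1 <= powR (2 - s) s * Gamma (2 - s) by apply: h; lra.
  apply: (le_trans h); rewrite ler_pM2r//.
  by apply: le_trans (powR_le_linear s (2 - s) _ _ _) _; lra.
have h3 : 1 + s * (1 - s) <= 5 / 4 by have := sqr_ge0 (s - 1 / 2); lra.
have h4 : 1 <= 5 / 4 * Gamma (1 + s) by rewrite (le_trans h1)// ler_wpM2r// ltW.
have h5 : 1 <= 5 / 4 * Gamma (2 - s) by rewrite (le_trans h2)// ler_wpM2r// ltW.
nra.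
Qed.

(** Two upward steps of length [s], from [x - s] to [x] and from [x] to [x + s], each costing at
    most [x^s]. *)
Lemma Gamma_ratio_ge {R : realType} (x s : R) : 0 <= s -> s <= 1 -> 1 < x ->
  (powR x (2 * s))^-1 <= Gamma (x - s) / Gamma (x + s).
Proof.
move=> s0 s1 x1.
have x0 : 0 < x by lra.
have g1 : 0 < Gamma (x + s) by apply: Gamma_gt0; lra.
have p0 : 0 < powR x s by exact: powR_gt0.
have e : powR x (2 * s) = powR x s * powR x s.
  by rewrite -powRD ?(gt_eqF x0) ?implybT//; congr powR; lra.
have h1 : Gamma (x + s) <= powR x s * Gamma x by exact: Gamma_le.
have h2 : Gamma x <= powR (x - s) s * Gamma (x - s).
  by have := @Gamma_le R (x - s) s; rewrite subrK; apply; lra.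
have h3 : powR (x - s) s <= powR x s by rewrite ge0_ler_powR ?nnegrE//; lra.
have g2 : 0 < Gamma (x - s) by apply: Gamma_gt0; lra.
have h4 : Gamma x <= powR x s * Gamma (x - s).
  by rewrite (le_trans h2)// ler_wpM2r// ltW.
have h5 := ler_wpM2l (ltW p0) h4.
rewrite e ler_pdivlMr// mulrC ler_pdivrMr ?mulr_gt0//; lra.
Qed.

(** The opposite direction uses steps of length [1 - s], from [x] and from [x + s], completed by the
    functional equation. The price is the shift by one: the arguments are centred at [x + 1], the
    power is that of [x]. *)
Lemma Gamma_ratio_le {R : realType} (x s : R) : 0 <= s -> s <= 1 -> 0 < x ->
  Gamma (x + 1 - s) / Gamma (x + 1 + s) <= (powR x (2 * s))^-1.
Proof.
move=> s0 s1 x0.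
have p0 : 0 < powR x s by exact: powR_gt0.
have e : powR x (2 * s) = powR x s * powR x s.
  by rewrite -powRD ?(gt_eqF x0) ?implybT//; congr powR; lra.
have g0 : 0 < Gamma x by exact: Gamma_gt0.
have g1 : 0 < Gamma (x + s) by apply: Gamma_gt0; lra.
have g2 : 0 < Gamma (x + 1 + s) by apply: Gamma_gt0; lra.
have ge1 (y : R) : 0 < y -> y = powR y s * powR y (1 - s).
  move=> y0; rewrite -powRD ?(gt_eqF y0) ?implybT//.
  have -> : s + (1 - s) = 1 by lra.
  by rewrite powRr1 ?ltW.
have h1 : powR x s * Gamma (x + 1 - s) <= x * Gamma x.
  have := @Gamma_le R x (1 - s) x0.
  have -> : x + (1 - s) = x + 1 - s by lra.
  move=> h; have {}h : Gamma (x + 1 - s) <= powR x (1 - s) * Gamma x by apply: h; lra.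
  have := ler_wpM2l (ltW p0) h; rewrite (mulrA (powR x s) (powR x (1 - s))).
  by rewrite -(ge1 x x0).
have h2 : powR x s * (x * Gamma x) <= Gamma (x + 1 + s).
  have -> : x + 1 + s = x + s + 1 by lra.
  have xs0 : 0 < x + s by lra.
  rewrite Gamma_succ// -(Gamma_succ x)//.
  have := @Gamma_le R (x + s) (1 - s) xs0.
  have -> : x + s + (1 - s) = x + 1 by lra.
  move=> h.
  have {}h : Gamma (x + 1) <= powR (x + s) (1 - s) * Gamma (x + s) by apply: h; lra.
  have := ler_wpM2l (powR_ge0 (x + s) s) h.
  rewrite (mulrA (powR (x + s) s) (powR (x + s) (1 - s))) -(ge1 (x + s) xs0).
  apply: le_trans; rewrite ler_wpM2r//; first by rewrite ltW// Gamma_gt0//; lra.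
  by rewrite ge0_ler_powR ?nnegrE//; lra.
rewrite ler_pdivrMr// mulrC ler_pdivlMr ?powR_gt0// e.
by rewrite (le_trans _ h2)// mulrC -mulrA ler_pM2l.
Qed.

Lemma sin_alpha_gt0 {R : realType} (alpha : R) : 0 < alpha -> alpha < 2 ->
  0 < sin (pi * alpha / 2).
Proof.
move=> a0 a2; have pi0 := @pi_gt0 R.
by apply: sin_gt0_pi; apply/andP; split; nra.
Qed.

Lemma theta_ge0 {R : realType} (alpha : R) : 1 < alpha -> alpha < 2 -> 0 <= theta alpha.
Proof.
move=> a1 a2; have pi0 := @pi_gt0 R.
have s0 : 0 < sin (pi * alpha / 2) by apply: sin_alpha_gt0; lra.
have G0 : 0 <= Gamma (alpha + 1) by rewrite ltW// Gamma_gt0//; lra.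
have K0 := theta_factor_ge0 alpha.
rewrite /theta -/(theta_factor alpha) divr_ge0//; first exact: mulr_ge0 (mulr_ge0 K0 G0) (ltW s0).
by rewrite mulr_ge0// ?ltW//; lra.
Qed.

Lemma theta0_gt0 {R : realType} (alpha : R) : 1 < alpha -> alpha < 2 -> 0 < theta0 alpha.
Proof.
move=> a1 a2; have pi0 := @pi_gt0 R.
have s0 : 0 < sin (pi * alpha / 2) by apply: sin_alpha_gt0; lra.
have G0 : 0 < Gamma (1 + alpha) by apply: Gamma_gt0; lra.
have a0 : 0 < alpha by lra.
rewrite /theta0 divr_gt0//; last exact: mulr_gt0.
have q0 : 0 < Num.sqrt 2 :> R by rewrite sqrtr_gt0.
exact: mulr_gt0 (mulr_gt0 (mulr_gt0 q0 (expR_gt0 _)) G0) s0.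
Qed.

(** Applied with [y] equal to [M + 1] and [M - 1/2] for the tail at [M = 2 p], and to [p + 1/2] for
    the tail at [p]. *)
Lemma coef_tail_ge {R : realType} (alpha y : R) (m : nat) : 1 < alpha -> alpha < 2 ->
  0 < y -> m.+2%:R <= 16 / 15 * y -> theta alpha / powR y alpha <= coef_tail alpha m.+2.
Proof.
move=> a1 a2 y0 my; have pi0 := @pi_gt0 R.
have a0 : 0 < alpha by lra.
have G0 : 0 < Gamma (alpha + 1) by apply: Gamma_gt0; lra.
have G1 : 0 < Gamma (1 + alpha / 2) by apply: Gamma_gt0; lra.
have G2 : 0 < Gamma (2 - alpha / 2) by apply: Gamma_gt0; lra.
rewrite coef_tailE; [|lra|lra].
have s1 : 0 < 1 - alpha / 2 by lra.
have := @Gamma_ratio_ge R m.+2%:R (alpha / 2).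
have -> : 2 * (alpha / 2) = alpha by lra.
move=> /(_ _ _ _) h1.
have {}h1 : (powR m.+2%:R alpha)^-1 <= Gamma (m.+2%:R - alpha / 2) / Gamma (m.+2%:R + alpha / 2).
  by apply: h1; rewrite ?ltr1n//; lra.
have yp : 0 < powR y alpha by exact: powR_gt0.
have rp : 0 < powR (16 / 15 : R) alpha by apply: powR_gt0; lra.
have h2 : powR m.+2%:R alpha <= powR (16 / 15) alpha * powR y alpha.
  rewrite -powRM; [|lra|lra].
  by rewrite ge0_ler_powR ?nnegrE//; lra.
have h3 : (powR (16 / 15) alpha * powR y alpha)^-1 <=
    Gamma (m.+2%:R - alpha / 2) / Gamma (m.+2%:R + alpha / 2).
  by rewrite (le_trans _ h1)// lef_pV2 ?posrE ?powR_gt0 ?mulr_gt0.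
have G12 := mulr_gt0 G1 G2.
have h4 : Gamma (alpha + 1) * (1 - alpha / 2) / 2 <=
    Gamma (alpha + 1) * (1 - alpha / 2) / (2 * (Gamma (1 + alpha / 2) * Gamma (2 - alpha / 2))).
  rewrite ler_pM2l; last exact: mulr_gt0 G0 s1.
  rewrite lef_pV2 ?posrE//; last exact: mulr_gt0.
  by have := @Gamma_prod_le1 R (alpha / 2) _ _; lra.
have h5 : theta alpha * powR (16 / 15) alpha <= Gamma (alpha + 1) * (1 - alpha / 2) / 2.
  have := theta_factor_sin_le alpha a1 a2 => h.
  have -> : theta alpha * powR (16 / 15) alpha =
    theta_factor alpha * sin (pi * alpha / 2) * powR (16 / 15) alpha * (Gamma (alpha + 1) / (pi * alpha)).
    by rewrite /theta -/(theta_factor alpha); ring.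
  have -> : Gamma (alpha + 1) * (1 - alpha / 2) / 2 =
     pi * (alpha / 2) * (1 - alpha / 2) * (Gamma (alpha + 1) / (pi * alpha)).
    have : pi != 0 :> R by rewrite gt_eqF.
    by move: (pi : R) => p p0; field; rewrite (gt_eqF a0) p0.
  by rewrite ler_wpM2r// (divr_ge0 (ltW G0))// (mulr_ge0 (ltW pi0) (ltW a0)).
have th0 := theta_ge0 alpha a1 a2.
apply: le_trans (ler_pM _ _ h4 h3).
- by rewrite invfM mulrA ler_pM2r ?invr_gt0// ler_pdivlMr.
- by apply: divr_ge0 => //; exact: mulr_ge0 (ltW G0) (ltW s1).
- by rewrite invr_ge0 mulr_ge0 ?powR_ge0.
Qed.

Lemma theta0_factor_ge4 {R : realType} : 4 <= Num.sqrt 2 * expR (13 / 12) :> R.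
Proof.
have h1 : 141 / 100 <= Num.sqrt 2 :> R.
  by rewrite -[leLHS]ger0_norm ?divr_ge0// -sqrtr_sqr ler_wsqrtr//; lra.
have h2 : 284 / 100 <= expR (13 / 12) :> R.
  apply: le_trans (@expR_ge_expr R (13 / 12) 15 _); last lra.
  lra.
nra.
Qed.

Lemma coef_tail_le {R : realType} (alpha : R) (m : nat) : 1 < alpha -> alpha < 2 ->
  coef_tail alpha m.+2 <= theta0 alpha / powR m.+1%:R alpha.
Proof.
move=> a1 a2; have pi0 := @pi_gt0 R.
have G0 : 0 < Gamma (alpha + 1) by apply: Gamma_gt0; lra.
have G1 : 0 < Gamma (1 + alpha / 2) by apply: Gamma_gt0; lra.
have G2 : 0 < Gamma (2 - alpha / 2) by apply: Gamma_gt0; lra.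
have s1 : 0 < 1 - alpha / 2 by lra.
rewrite coef_tailE; [|lra|lra].
have := @Gamma_ratio_le R m.+1%:R (alpha / 2).
have -> : 2 * (alpha / 2) = alpha by lra.
rewrite natr1 => h1.
have {}h1 : Gamma (m.+2%:R - alpha / 2) / Gamma (m.+2%:R + alpha / 2) <= (powR m.+1%:R alpha)^-1.
  by apply: h1; rewrite ?ltr0n//; lra.
apply: ler_pM => //.
- apply: divr_ge0; first exact: mulr_ge0 (ltW G0) (ltW s1).
  by rewrite mulr_ge0// (ltW (mulr_gt0 G1 G2)).
- have m2 : 2 <= m.+2%:R :> R by rewrite ler_nat.
  by apply: divr_ge0; apply/ltW/Gamma_gt0; lra.
have h2 : Gamma (alpha + 1) * (1 - alpha / 2) / (2 * (Gamma (1 + alpha / 2) * Gamma (2 - alpha / 2)))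
    <= Gamma (alpha + 1) * (1 - alpha / 2).
  rewrite ler_piMr//; first exact: mulr_ge0 (ltW G0) (ltW s1).
  rewrite invf_le1; last exact: mulr_gt0 _ (mulr_gt0 G1 G2).
  by have := @Gamma_prod_ge_half R (alpha / 2) _ _; lra.
apply: (le_trans h2).
have h3 : pi * (1 - alpha / 2) / 2 <= sin (pi * alpha / 2).
  have h0 : 0 <= pi * (alpha / 2 - 1 / 2) by apply: mulr_ge0; lra.
  rewrite sin_pi_half_alpha; apply: half_le_sin; last lra.
  exact: mulr_ge0 (ltW pi0) (ltW s1).
have h4 := @theta0_factor_ge4 R.
(* Of the factor 4, one 2 pays for the loss in [half_le_sin] and the other for replacing [alpha] by
   2. *)
have h5 : 4 * (pi * (1 - alpha / 2) / 2) <= Num.sqrt 2 * expR (13 / 12) * sin (pi * alpha / 2).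
  by rewrite ler_pM// divr_ge0// (mulr_ge0 (ltW pi0) (ltW s1)).
have -> : theta0 alpha = Gamma (alpha + 1) *
    (Num.sqrt 2 * expR (13 / 12) * sin (pi * alpha / 2) / (pi * alpha)).
  by rewrite /theta0 (addrC 1); ring.
have a0 : 0 < alpha by lra.
rewrite ler_pM2l// ler_pdivlMr; last exact: mulr_gt0.
have h6 : 0 <= pi * (1 - alpha / 2) * (2 - alpha).
  by apply: mulr_ge0; [exact: mulr_ge0 (ltW pi0) (ltW s1)|lra].
lra.
Qed.

(** * Spectral norm bounds *)

Definition dotv {R : realType} {n : nat} (u v : 'cV[R]_n) : R := \sum_i u i 0 * v i 0.
Definition normsq {R : realType} {n : nat} (v : 'cV[R]_n) : R := dotv v v.

Section Dot.
Context {R : realType} {n : nat}.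
Implicit Types (u v w : 'cV[R]_n) (c : R).

Lemma dotvC u v : dotv u v = dotv v u.
Proof. by apply: eq_bigr => i _; rewrite mulrC. Qed.

Lemma dotvDl u v w : dotv (u + v) w = dotv u w + dotv v w.
Proof. by rewrite -big_split/=; apply: eq_bigr => i _; rewrite mxE mulrDl. Qed.

Lemma dotvNl u v : dotv (- u) v = - dotv u v.
Proof. by rewrite -sumrN; apply: eq_bigr => i _; rewrite mxE mulNr. Qed.

Lemma dotvZl c u v : dotv (c *: u) v = c * dotv u v.
Proof. by rewrite mulr_sumr; apply: eq_bigr => i _; rewrite mxE mulrA. Qed.

Lemma dotvDr u v w : dotv w (u + v) = dotv w u + dotv w v.
Proof. by rewrite dotvC dotvDl !(dotvC w). Qed.

Lemma dotvNr u v : dotv v (- u) = - dotv v u.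
Proof. by rewrite dotvC dotvNl (dotvC v). Qed.

Lemma dotvZr c u v : dotv v (c *: u) = c * dotv v u.
Proof. by rewrite dotvC dotvZl (dotvC v). Qed.

Lemma normsqE v : normsq v = \sum_i v i 0 ^+ 2.
Proof. by apply: eq_bigr => i _; rewrite expr2. Qed.

Lemma normsq_ge0 v : 0 <= normsq v.
Proof. by rewrite normsqE sumr_ge0// => i _; exact: sqr_ge0. Qed.

Lemma normsqD u v : normsq (u + v) = normsq u + 2 * dotv u v + normsq v.
Proof. by rewrite /normsq !dotvDl !dotvDr (dotvC v u); ring. Qed.

Lemma normsqN v : normsq (- v) = normsq v.
Proof. by rewrite /normsq dotvNl dotvNr opprK. Qed.

Lemma normsqZ c v : normsq (c *: v) = c ^+ 2 * normsq v.
Proof. by rewrite /normsq dotvZl dotvZr mulrA expr2. Qed.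

Lemma normsqB u v : normsq (u - v) = normsq u - 2 * dotv u v + normsq v.
Proof. by rewrite normsqD normsqN dotvNr; ring. Qed.

Lemma normsqB_le u v : normsq (u - v) <= 2 * normsq u + 2 * normsq v.
Proof. by have := normsq_ge0 (u + v); rewrite normsqB normsqD; lra. Qed.

Lemma normsq_eq0 v : normsq v <= 0 -> v = 0.
Proof.
move=> h; have /eqP : normsq v = 0 by apply/le_anti; rewrite h normsq_ge0.
rewrite normsqE psumr_eq0 => [/allP h0|i _]; last exact: sqr_ge0.
apply/colP => i; rewrite mxE; apply/eqP; rewrite -sqrf_eq0.
exact: h0 (mem_index_enum _).
Qed.

Lemma vnorm2E v : vnorm2 v = Num.sqrt (normsq v).
Proof. by rewrite normsqE. Qed.

Lemma dotv_mulmx (A : 'M[R]_n) u v : dotv (A *m u) v = dotv u (A^T *m v).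
Proof.
rewrite /dotv; under eq_bigr do rewrite mxE mulr_suml.
rewrite exchange_big/=; apply: eq_bigr => j _.
rewrite mxE mulr_sumr; apply: eq_bigr => i _; rewrite mxE; ring.
Qed.

Lemma dotv_mulmxE (A : 'M[R]_n) v :
  dotv v (A *m v) = \sum_i \sum_j v i 0 * A i j * v j 0.
Proof.
by apply: eq_bigr => i _; rewrite mxE mulr_sumr; apply: eq_bigr => j _; rewrite mulrA.
Qed.
End Dot.

Lemma dotv_col_mx {R : realType} {m n : nat} (x x' : 'cV[R]_m) (y y' : 'cV[R]_n) :
  dotv (col_mx x y) (col_mx x' y') = dotv x x' + dotv y y'.
Proof.
rewrite /dotv big_split_ord/=; congr (_ + _); apply: eq_bigr => i _.
  by rewrite !col_mxEu.
by rewrite !col_mxEd.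
Qed.

Lemma normsq_col_mx {R : realType} {m n : nat} (x : 'cV[R]_m) (y : 'cV[R]_n) :
  normsq (col_mx x y) = normsq x + normsq y.
Proof. exact: dotv_col_mx. Qed.

(* [c] bounds the square of the spectral norm. *)
Definition sqbound {R : realType} {m n : nat} (A : 'M[R]_(m, n)) (c : R) : Prop :=
  forall v : 'cV[R]_n, normsq (A *m v) <= c * normsq v.

Lemma spec_norm_le {R : realType} {m n : nat} (A : 'M[R]_(m, n)) (c : R) :
  0 <= c -> sqbound A (c ^+ 2) -> spec_norm A <= c.
Proof.
move=> c0 hA; apply: ge_sup.
  exists (vnorm2 (A *m 0)); exists 0 => //=.
  by rewrite vnorm2E /normsq /dotv big1 ?sqrtr0// => i _; rewrite mxE mulr0.
move=> _ [v /= v1 <-]; rewrite vnorm2E.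
have nv : normsq v <= 1.
  rewrite -(sqr_sqrtr (normsq_ge0 _)) -vnorm2E expr_le1//.
  by rewrite vnorm2E sqrtr_ge0.
rewrite -[leRHS]ger0_norm// -sqrtr_sqr ler_wsqrtr// (le_trans (hA v))//.
by rewrite ler_piMr// sqr_ge0.
Qed.

Lemma sqboundM {R : realType} {m n p : nat} (A : 'M[R]_(m, n)) (B : 'M[R]_(n, p)) (a b : R) :
  0 <= a -> sqbound A a -> sqbound B b -> sqbound (A *m B) (a * b).
Proof.
move=> a0 hA hB v; rewrite -mulmxA (le_trans (hA _))// -mulrA ler_wpM2l//.
Qed.

Lemma sqboundW {R : realType} {m n : nat} (A : 'M[R]_(m, n)) (a b : R) :
  a <= b -> sqbound A a -> sqbound A b.
Proof. by move=> ab hA v; rewrite (le_trans (hA v))// ler_wpM2r// normsq_ge0. Qed.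

Lemma sqbound_block_diag {R : realType} {n : nat} (A : 'M[R]_n) (a : R) :
  sqbound A a -> sqbound (block_mx A 0 0 A) a.
Proof.
move=> hA v; rewrite -[v]vsubmxK mul_block_col !mul0mx addr0 add0r !normsq_col_mx.
by rewrite mulrDr lerD.
Qed.

Lemma normsq_ge_unitmx {R : realType} {n : nat} (A : 'M[R]_n) (c : R) : 0 < c ->
  (forall v, c * normsq v <= normsq (A *m v)) -> A \in unitmx.
Proof.
move=> c0 h; rewrite -unitmx_tr unitmxE unitfE; apply/det0P => -[v vN0 vA].
move/negP: vN0; apply.
have Av : A *m v^T = 0 by rewrite -[A]trmxK -trmx_mul vA trmx0.
have := h v^T; rewrite Av.
have -> : normsq (0 : 'cV[R]_n) = 0 by rewrite /normsq -(scale0r 0) dotvZl mul0r.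
rewrite pmulr_rle0// => /normsq_eq0 v0.
by rewrite -[v]trmxK v0 trmx0.
Qed.

Lemma sqbound_invmx {R : realType} {n : nat} (A : 'M[R]_n) (c : R) : 0 < c ->
  (forall v, c * normsq v <= normsq (A *m v)) -> sqbound (invmx A) c^-1.
Proof.
move=> c0 h v; have uA := normsq_ge_unitmx _ _ c0 h.
by rewrite -(ler_pM2l c0) mulrA mulfV ?gt_eqF// mul1r (le_trans (h _))// mulKVmx.
Qed.

(** Expanding [0 <= |A v - c v|^2] replaces Cauchy-Schwarz and avoids square roots. *)
Lemma coercive_normsq_ge {R : realType} {n : nat} (A : 'M[R]_n) (c : R) : 0 <= c ->
  (forall v, c * normsq v <= dotv v (A *m v)) ->
  forall v, c ^+ 2 * normsq v <= normsq (A *m v).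
Proof.
move=> c0 h v; have := normsq_ge0 (A *m v - c *: v).
rewrite normsqB normsqZ dotvZr (dotvC (A *m v)).
by have := ler_wpM2l c0 (h v); lra.
Qed.

Lemma coercive_unitmx {R : realType} {n : nat} (A : 'M[R]_n) (c : R) : 0 < c ->
  (forall v, c * normsq v <= dotv v (A *m v)) -> A \in unitmx.
Proof.
move=> c0 h; apply: (normsq_ge_unitmx _ (c ^+ 2)); first exact: exprn_gt0.
exact: coercive_normsq_ge (ltW c0) h.
Qed.

(** Gershgorin's argument via [2 |a b| <= a^2 + b^2]. The row sum includes the diagonal entry,
    whence the coefficient 2 of [A i i]. *)
Lemma diag_dominant_coercive {R : realType} {n : nat} (A : 'M[R]_n) (c : R) :
  A^T = A -> (forall i, 0 <= A i i) ->
  (forall i, c <= 2 * A i i - \sum_j `|A i j|) ->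
  forall v, c * normsq v <= dotv v (A *m v).
Proof.
move=> sA dA hc v; rewrite dotv_mulmxE.
have h1 i j : (if i == j then 2 * A i i * v i 0 ^+ 2 else 0)
    - `|A i j| * v i 0 ^+ 2 / 2 - `|A i j| * v j 0 ^+ 2 / 2 <= v i 0 * A i j * v j 0.
  case: eqP => [<-|_]; first by rewrite ger0_norm//; nra.
  have [hp|hn] := leP 0 (A i j).
    by rewrite (ger0_norm hp); have := mulr_ge0 hp (sqr_ge0 (v i 0 + v j 0)); lra.
  have hn' : 0 <= - A i j by lra.
  by rewrite (ltr0_norm hn); have := mulr_ge0 hn' (sqr_ge0 (v i 0 - v j 0)); lra.
apply: le_trans (_ : \sum_i \sum_j ((if i == j then 2 * A i i * v i 0 ^+ 2 else 0)
    - `|A i j| * v i 0 ^+ 2 / 2 - `|A i j| * v j 0 ^+ 2 / 2) <= _); last first.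
  by apply: ler_sum => i _; apply: ler_sum => j _; exact: h1.
have e1 : \sum_i \sum_j `|A i j| * v j 0 ^+ 2 / 2 = \sum_i \sum_j `|A i j| * v i 0 ^+ 2 / 2.
  rewrite exchange_big/=; apply: eq_bigr => i _; apply: eq_bigr => j _.
  by rewrite -{1}sA mxE.
under eq_bigr do rewrite !sumrB.
rewrite !sumrB e1 -!sumrB normsqE mulr_sumr; apply: ler_sum => i _.
rewrite -big_mkcond/= (big_pred1 i) => [|j]; last by rewrite eq_sym.
rewrite -!mulr_suml.
have := ler_wpM2r (sqr_ge0 (v i 0)) (hc i); lra.
Qed.

(** Weighted Cauchy-Schwarz in each row, derived from the nonnegative terms
    [|A i j| |A i k| (|v j| - |v k|)^2]; the column sums are used when adding the rows up. *)
Lemma schur_test {R : realType} {n : nat} (A : 'M[R]_n) (r : R) : 0 <= r ->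
  (forall i, \sum_j `|A i j| <= r) -> (forall j, \sum_i `|A i j| <= r) ->
  sqbound A (r ^+ 2).
Proof.
move=> r0 hr hc v.
have row i : (A *m v) i 0 ^+ 2 <= r * \sum_j `|A i j| * v j 0 ^+ 2.
  have S0 : 0 <= \sum_j `|A i j| * v j 0 ^+ 2.
    by apply: sumr_ge0 => j _; rewrite mulr_ge0// sqr_ge0.
  apply: le_trans (ler_wpM2r S0 (hr i)).
  rewrite mxE expr2 !mulr_suml.
  have -> : \sum_j `|A i j| * (\sum_j0 `|A i j0| * v j0 0 ^+ 2) =
    \sum_j \sum_k (`|A i j| * `|A i k| * v j 0 ^+ 2 / 2 + `|A i j| * `|A i k| * v k 0 ^+ 2 / 2).
    have e : \sum_j \sum_k `|A i j| * `|A i k| * v j 0 ^+ 2 / 2 =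
        \sum_j \sum_k `|A i j| * `|A i k| * v k 0 ^+ 2 / 2.
      rewrite exchange_big/=; apply: eq_bigr => j _; apply: eq_bigr => k _.
      by rewrite (mulrC `|A i k|).
    under [RHS]eq_bigr do rewrite big_split/=.
    rewrite big_split/= e -big_split/=; apply: eq_bigr => j _.
    rewrite -big_split/= mulr_sumr; apply: eq_bigr => k _; lra.
  apply: ler_sum => j _; rewrite mulr_sumr; apply: ler_sum => k _.
  have := mulr_ge0 (mulr_ge0 (normr_ge0 (A i j)) (normr_ge0 (A i k)))
    (sqr_ge0 (`|v j 0| - `|v k 0|)).
  rewrite sqrrB !real_normK ?num_real//.
  have := ler_norm (A i j * v j 0 * (A i k * v k 0)); rewrite !normrM; lra.
rewrite normsqE (le_trans (ler_sum _ (fun i _ => row i)))//.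
rewrite -mulr_sumr expr2 -mulrA ler_wpM2l// exchange_big/= normsqE mulr_sumr.
apply: ler_sum => j _; rewrite -mulr_suml ler_wpM2r ?sqr_ge0//.
Qed.

(** * Skew block matrices and Cayley contractions *)

Lemma tr_scalarD {R : realType} {n : nat} (E : 'M[R]_n) (w : R) :
  E^T = E -> (w%:M + E)^T = w%:M + E.
Proof. by move=> sE; rewrite linearD/= tr_scalar_mx sE. Qed.

Definition skew_block {R : realType} {n : nat} (E : 'M[R]_n) : 'M[R]_(n + n) :=
  block_mx E (- 1%:M) 1%:M E.

Lemma scalarD_skew_block {R : realType} {n : nat} (w : R) (E : 'M[R]_n) :
  w%:M + skew_block E = skew_block (w%:M + E).
Proof. by rewrite /skew_block scalar_mx_block add_block_mx !add0r. Qed.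

(** The cross terms cancel because [E] is symmetric. This is the origin of the [1 +] under the
    square roots of [xi]. *)
Lemma normsq_skew_block {R : realType} {n : nat} (E : 'M[R]_n) (x y : 'cV[R]_n) :
  E^T = E -> normsq (skew_block E *m col_mx x y) =
  normsq (E *m x) + normsq (E *m y) + (normsq x + normsq y).
Proof.
move=> sE; rewrite mul_block_col mulNmx !mul1mx normsq_col_mx normsqB normsqD.
by rewrite dotv_mulmx sE; ring.
Qed.

Lemma dotv_skew_block {R : realType} {n : nat} (E : 'M[R]_n) (x y : 'cV[R]_n) :
  dotv (col_mx x y) (skew_block E *m col_mx x y) = dotv x (E *m x) + dotv y (E *m y).
Proof.
by rewrite mul_block_col mulNmx !mul1mx dotv_col_mx !dotvDr dotvNr (dotvC y x); ring.
Qed.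

Lemma skew_block_coercive {R : realType} {n : nat} (E : 'M[R]_n) (c : R) :
  (forall v, c * normsq v <= dotv v (E *m v)) ->
  forall v, c * normsq v <= dotv v (skew_block E *m v).
Proof.
by move=> h v; rewrite -[v]vsubmxK dotv_skew_block normsq_col_mx mulrDr lerD.
Qed.

Lemma skew_block_normsq_ge {R : realType} {n : nat} (E : 'M[R]_n) (c : R) :
  E^T = E -> (forall v, c * normsq v <= normsq (E *m v)) ->
  forall v, (1 + c) * normsq v <= normsq (skew_block E *m v).
Proof.
move=> sE h v; rewrite -[v]vsubmxK normsq_skew_block// normsq_col_mx.
have := h (usubmx v); have := h (dsubmx v); lra.
Qed.

Lemma sqbound_skew_block {R : realType} {n : nat} (E : 'M[R]_n) (c : R) :
  E^T = E -> sqbound E c -> sqbound (skew_block E) (1 + c).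
Proof.
move=> sE h v; rewrite -[v]vsubmxK normsq_skew_block// normsq_col_mx.
have := h (usubmx v); have := h (dsubmx v); lra.
Qed.

Lemma scalarD_coercive {R : realType} {n : nat} (w c : R) (E : 'M[R]_n) :
  (forall v, c * normsq v <= dotv v (E *m v)) ->
  forall v, (w + c) * normsq v <= dotv v ((w%:M + E) *m v).
Proof.
move=> h v; rewrite mulmxDl mul_scalar_mx dotvDr dotvZr mulrDl.
by rewrite lerD2l.
Qed.

(** The two sides differ by [4 w] times the quadratic form of [E]. *)
Lemma normsq_shift_le {R : realType} {n : nat} (w : R) (E : 'M[R]_n) (v : 'cV[R]_n) :
  0 <= w -> 0 <= dotv v (E *m v) ->
  normsq ((w%:M - E) *m v) <= normsq ((w%:M + E) *m v).
Proof.
move=> w0 h; rewrite mulmxBl mulmxDl mul_scalar_mx normsqB normsqD dotvZl.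
by have := mulr_ge0 w0 h; lra.
Qed.

Lemma sqbound_cayley {R : realType} {n : nat} (w : R) (E : 'M[R]_n) :
  0 <= w -> (forall v, 0 <= dotv v (E *m v)) -> w%:M + E \in unitmx ->
  sqbound ((w%:M - E) *m invmx (w%:M + E)) 1.
Proof.
move=> w0 h u v; rewrite mul1r -mulmxA (le_trans (normsq_shift_le w E _ w0 (h _)))//.
by rewrite mulKVmx.
Qed.

(** Here the inverse stands on the left, so the estimate is made coordinatewise from
    [|w - d| <= w + d]. *)
Lemma sqbound_cayley_diag {R : realType} {n : nat} (w : R) (d : 'rV[R]_n) :
  0 < w -> (forall i, 0 <= d 0 i) ->
  sqbound (invmx (w%:M + diag_mx d) *m (w%:M - diag_mx d)) 1.
Proof.
move=> w0 d0.
have u : w%:M + diag_mx d \in unitmx.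
  have h v : 0 * normsq v <= dotv v (diag_mx d *m v).
    rewrite mul0r; apply: sumr_ge0 => i _.
    by rewrite mul_diag_mx mxE mulrCA -expr2 mulr_ge0// sqr_ge0.
  apply: (coercive_unitmx _ w) => // v.
  by have := scalarD_coercive w 0 _ h v; rewrite addr0.
move=> v; rewrite mul1r; set x := _ *m v.
have e : (w%:M + diag_mx d) *m x = (w%:M - diag_mx d) *m v.
  by rewrite /x -mulmxA mulKVmx.
clearbody x; rewrite !normsqE; apply: ler_sum => i _.
have := congr1 (fun z : 'cV[R]_n => z i 0) e.
rewrite mulmxDl mulmxBl !mul_scalar_mx !mul_diag_mx !mxE => ei.
have di := d0 i.
have p : 0 < w + d 0 i by lra.
have hx : (w + d 0 i) * x i 0 = (w - d 0 i) * v i 0 by lra.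
have : (w + d 0 i) ^+ 2 * x i 0 ^+ 2 <= (w + d 0 i) ^+ 2 * v i 0 ^+ 2.
  rewrite -exprMn hx exprMn ler_wpM2r ?sqr_ge0//.
  by have := mulr_ge0 (ltW w0) di; lra.
by rewrite ler_pM2l ?exprn_gt0.
Qed.

(** * Perturbation of the splitting preconditioner *)

(** [Ft^-1 F = A3^-1 A2 = 1 + A3^-1 (A2 - A3)]: the common factor [A1] cancels. *)
Lemma invmx_perturb {R : realType} {n : nat} (k : R) (A1 A2 A3 P : 'M[R]_n) :
  k != 0 -> A1 \in unitmx -> A2 \in unitmx -> A3 \in unitmx ->
  let F := k *: (A1 *m A2) in let Ft := k *: (A1 *m A3) in
  invmx Ft *m P = invmx F *m P + invmx A3 *m (A2 - A3) *m (invmx F *m P).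
Proof.
move=> k0 u1 u2 u3 F Ft.
have uF : F \in unitmx by rewrite unitmxZ ?unitfE// unitmx_mul u1.
have uFt : Ft \in unitmx by rewrite unitmxZ ?unitfE// unitmx_mul u1.
rewrite mulmxBr mulVmx// mulmxBl mul1mx addrC subrK.
apply/esym/(canRL (mulKmx uFt)).
rewrite -[RHS](mulKVmx uF P) !mulmxA; congr (_ *m _ *m _).
by rewrite /Ft /F -!scalemxAl mulmxK.
Qed.

(** Rests on [(w + B)(w + H) - (w - B)(w - H) = 2 w (B + H)]; conjugation by [w + H] puts [U] and
    [V] next to each other. *)
Lemma preconditioned_similar {R : realType} {n : nat} (w : R) (B H : 'M[R]_n) :
  0 < w -> w%:M + B \in unitmx -> w%:M + H \in unitmx ->
  invmx ((2 * w)^-1 *: ((w%:M + B) *m (w%:M + H))) *m (B + H) =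
  invmx (w%:M + H) *m (1%:M - (invmx (w%:M + B) *m (w%:M - B)) *m
    ((w%:M - H) *m invmx (w%:M + H))) *m (w%:M + H).
Proof.
move=> w0 u1 u2.
have k0 : 2 * w != 0 by rewrite mulf_neq0 ?gt_eqF.
have uF : (2 * w)^-1 *: ((w%:M + B) *m (w%:M + H)) \in unitmx.
  by rewrite unitmxZ ?unitfE ?invr_eq0// unitmx_mul u1.
apply/esym/(canRL (mulKmx uF)).
have e : (w%:M + B) *m (w%:M + H) *m (invmx (w%:M + H) *m
    (1%:M - (invmx (w%:M + B) *m (w%:M - B)) *m ((w%:M - H) *m invmx (w%:M + H))) *m
    (w%:M + H)) = (w%:M + B) *m (w%:M + H) - (w%:M - B) *m (w%:M - H).
  rewrite 2!mulmxA mulmxK// mulmxBr mulmx1 mulmxBl; congr (_ - _).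
  by rewrite !mulmxA mulmxV// mul1mx mulmxKV.
rewrite -scalemxAl e !mulmxDl !mulmxDr !mul_scalar_mx !mul_mx_scalar.
rewrite !mulNmx !mulmxN opprK.
apply: (scalerI k0); rewrite scalerA mulfV// scale1r.
move: (B *m H) => BH; apply/matrixP => i j; rewrite !mxE; ring.
Qed.

Lemma sqbound1B {R : realType} {n : nat} (U V : 'M[R]_n) :
  sqbound U 1 -> sqbound V 1 -> sqbound (1%:M - U *m V) 4.
Proof.
move=> hU hV v; rewrite mulmxBl mul1mx (le_trans (normsqB_le _ _))//.
have := sqboundM _ _ _ _ ler01 hU hV v; rewrite mulr1; lra.
Qed.

Lemma mxrank_block_diag {R : realType} {n : nat} (A : 'M[R]_n) :
  \rank (block_mx A 0 0 A) = (\rank A + \rank A)%N.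
Proof. by rewrite rank_diag_block_mx. Qed.

Lemma mxrank_unit_conj {R : realType} {n : nat} (P A Q : 'M[R]_n) :
  P \in unitmx -> Q \in unitmx -> \rank (P *m A *m Q) = \rank A.
Proof.
move=> uP uQ; rewrite mxrankMfree ?row_free_unit//.
by rewrite (eqmxMfull A (_ : row_full P)) ?row_full_unit.
Qed.

Lemma splitting_perturbation {R : realType} {n : nat} (T C D X Y : 'M[R]_n)
    (w lT lC L x y : R) :
  0 < w -> 0 < lT -> 0 <= lC -> T^T = T -> C^T = C ->
  (forall i j, i != j -> D i j = 0) -> (forall i, D i i <= 0) ->
  (forall v, lT * normsq v <= dotv v (T *m v)) ->
  (forall v, lC * normsq v <= dotv v (C *m v)) ->
  sqbound (w%:M + T) ((w + L) ^+ 2) ->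
  T - C = X + Y -> sqbound X (x ^+ 2) -> sqbound Y (y ^+ 2) ->
  let Rm : 'M[R]_(n + n) := block_mx (T - D) (- 1%:M) 1%:M (T - D) in
  let Bm : 'M[R]_(n + n) := block_mx (- D) 0 0 (- D) in
  let Hm : 'M[R]_(n + n) := block_mx T (- 1%:M) 1%:M T in
  let Cm : 'M[R]_(n + n) := block_mx C (- 1%:M) 1%:M C in
  let F : 'M[R]_(n + n) := (2 * w)^-1 *: ((w%:M + Bm) *m (w%:M + Hm)) in
  let Ft : 'M[R]_(n + n) := (2 * w)^-1 *: ((w%:M + Bm) *m (w%:M + Cm)) in
  let K := (1 + (w + lC) ^+ 2)^-1 * ((1 + (w + lT) ^+ 2)^-1 * (4 * (1 + (w + L) ^+ 2))) in
  exists Mw Nw : 'M[R]_(n + n),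
    [/\ \rank Mw = (\rank X + \rank X)%N, sqbound Mw (K * x ^+ 2), sqbound Nw (K * y ^+ 2) &
      invmx Ft *m Rm = invmx F *m Rm + Mw + Nw].
Proof.
move=> w0 lT0 lC0 sT sC Doff Ddiag hT hC hL TC hX hY Rm Bm Hm Cm F Ft K.
pose d : 'rV[R]_n := \row_i - D i i.
have ND : - D = diag_mx d.
  apply/matrixP => i j; rewrite !mxE; have [->|ij] := eqVneq i j; first by rewrite mulr1n.
  by rewrite (Doff _ _ ij) oppr0.
have BmE : Bm = diag_mx (row_mx d d) by rewrite diag_mx_row -ND.
have dd i : 0 <= row_mx d d 0 i.
  by rewrite mxE; case: (fintype.split i) => k; rewrite mxE oppr_ge0.
have RmE : Rm = Bm + Hm.
  by rewrite /Rm /Bm /Hm add_block_mx !add0r (addrC T).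
have Bpos v : 0 * normsq v <= dotv v (Bm *m v).
  rewrite mul0r BmE; apply: sumr_ge0 => i _.
  by rewrite mul_diag_mx mxE mulrCA -expr2 mulr_ge0// sqr_ge0.
have Hco := skew_block_coercive T lT hT.
have uB : w%:M + Bm \in unitmx.
  apply: (coercive_unitmx _ w) => // v.
  by have := scalarD_coercive w 0 _ Bpos v; rewrite addr0.
have AT := scalarD_coercive w _ _ hT; have AC := scalarD_coercive w _ _ hC.
have sqT : 0 < 1 + (w + lT) ^+ 2 by rewrite ltr_wpDr// sqr_ge0.
have sqC : 0 < 1 + (w + lC) ^+ 2 by rewrite ltr_wpDr// sqr_ge0.
have geH v : (1 + (w + lT) ^+ 2) * normsq v <= normsq ((w%:M + Hm) *m v).
  rewrite scalarD_skew_block; apply: skew_block_normsq_ge; first exact: tr_scalarD.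
  by apply: coercive_normsq_ge => //; lra.
have geC v : (1 + (w + lC) ^+ 2) * normsq v <= normsq ((w%:M + Cm) *m v).
  rewrite scalarD_skew_block; apply: skew_block_normsq_ge; first exact: tr_scalarD.
  by apply: coercive_normsq_ge => //; lra.
have uH := normsq_ge_unitmx _ _ sqT geH; have uC := normsq_ge_unitmx _ _ sqC geC.
(* Coercivity of [R] makes [W] invertible, so that multiplication by it preserves the rank. *)
have uR : Rm \in unitmx.
  apply: (coercive_unitmx _ lT) => // v; rewrite RmE mulmxDl dotvDr.
  by have := Bpos v; have := Hco v; rewrite -/(skew_block T); lra.
have k0 : (2 * w)^-1 != 0 by rewrite invr_eq0 mulf_neq0 ?gt_eqF.
have uF : F \in unitmx by rewrite unitmxZ ?unitfE// unitmx_mul uB.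
pose W := invmx F *m Rm.
have uW : W \in unitmx by rewrite unitmx_mul unitmx_inv uF.
have bW : sqbound W ((1 + (w + lT) ^+ 2)^-1 * (4 * (1 + (w + L) ^+ 2))).
  rewrite /W RmE /F preconditioned_similar// -mulmxA.
  apply: sqboundM; first by rewrite invr_ge0 ltW.
    exact: sqbound_invmx.
  apply: sqboundM => //; last first.
    by rewrite scalarD_skew_block; apply: sqbound_skew_block => //; exact: tr_scalarD.
  apply: sqbound1B; first by rewrite BmE; exact: sqbound_cayley_diag.
  apply: sqbound_cayley => //; first exact: ltW.
  by move=> v; apply: le_trans (Hco v); rewrite mulr_ge0 ?normsq_ge0 ?ltW.
have bC := sqbound_invmx _ _ sqC geC.
have bM (Z : 'M[R]_n) z : sqbound Z (z ^+ 2) ->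
    sqbound (invmx (w%:M + Cm) *m block_mx Z 0 0 Z *m W) (K * z ^+ 2).
  move=> hZ; rewrite /K -mulrA [X in _ * X]mulrC mulrA.
  apply: sqboundM => //; first by rewrite mulr_ge0 ?sqr_ge0// invr_ge0 ltW.
  apply: sqboundM => //; first by rewrite invr_ge0 ltW.
  exact: sqbound_block_diag.
exists (invmx (w%:M + Cm) *m block_mx X 0 0 X *m W).
exists (invmx (w%:M + Cm) *m block_mx Y 0 0 Y *m W); split; [|exact: bM|exact: bM|].
  by rewrite mxrank_unit_conj ?unitmx_inv// mxrank_block_diag.
rewrite (invmx_perturb _ _ _ _ Rm k0 uB uH uC) -/F -/W -[RHS]addrA -mulmxDl -mulmxDr.
congr (_ + _ *m _ *m _).
by rewrite add_block_mx !addr0 -TC /Hm /Cm opprD addrACA subrr add0r opp_block_mx add_block_mx !subrr.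
Qed.

(** * Symmetric Toeplitz matrices *)

Definition ndist (i j : nat) : nat := (i - j + (j - i))%N.

Definition distmx {R : realType} (M : nat) (f : nat -> R) : 'M[R]_M :=
  \matrix_(i < M, j < M) f (ndist i j).

Lemma tr_distmx {R : realType} (M : nat) (f : nat -> R) : (distmx M f)^T = distmx M f.
Proof. by apply/matrixP => i j; rewrite !mxE /ndist addnC. Qed.

Lemma sum_ndist {R : realType} (M : nat) (f : nat -> R) (i : 'I_M) :
  \sum_(j < M) f (ndist i j) =
  \sum_(0 <= d < i.+1) f d + \sum_(1 <= d < M - i) f d.
Proof.
rewrite -(big_mkord xpredT (fun j => f (ndist i j))).
rewrite (big_cat_nat (n := i.+1))//=; congr (_ + _).
  rewrite [RHS]big_nat_rev/=; apply: eq_big_nat => j /andP[_ ji].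
  by congr f; rewrite /ndist; lia.
rewrite -[X in \sum_(X <= _ < _) _]add1n big_addn; apply: eq_big_nat => j _.
by congr f; rewrite /ndist; lia.
Qed.

(** The largest distances to the left and to the right of [i] add up to [M - 1 < 2 p], so only one
    of the two ranges can reach [p]. *)
Lemma sum_ndist_sub {R : realType} (M p i : nat) (g : nat -> R) :
  (forall d, 0 <= g d) -> (forall d, (d < p)%N -> g d = 0) ->
  (M <= p + p)%N -> (i < M)%N ->
  \sum_(0 <= d < i.+1) g d + \sum_(1 <= d < M - i) g d <= \sum_(p <= d < M) g d.
Proof.
move=> g0 gp Mp iM.
have zero a b : (b <= p)%N -> \sum_(a <= d < b) g d = 0.
  by move=> bp; rewrite big_nat_cond big1// => d /andP[/andP[_ db] _]; apply: gp; lia.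
have sub a b : (a <= p)%N -> (b <= M)%N -> \sum_(a <= d < b) g d <= \sum_(p <= d < M) g d.
  move=> ap bM; have [bp|pb] := leqP b p; first by rewrite zero// sumr_ge0.
  rewrite (big_cat_nat (n := p))//=; last exact: ltnW.
  rewrite zero// add0r [leRHS](big_cat_nat (n := b))//=; last exact: ltnW.
  by rewrite lerDl sumr_ge0.
have [ip|pi] := ltnP i p; first by rewrite zero// add0r sub//; lia.
by rewrite [X in _ + X]zero ?addr0; [exact: sub|lia].
Qed.

Lemma sum_nat_mirror {R : realType} (p : nat) (F : nat -> R) : (0 < p)%N ->
  \sum_(p <= d < p + p) F (p + p - d)%N = \sum_(1 <= m < p.+1) F m.
Proof.
move=> p0; rewrite big_nat_rev/=.
rewrite -[X in \sum_(X <= _ < _) _](@subnKC 1 p)// big_addn.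
have -> : (p + p - (p - 1) = p.+1)%N by lia.
by apply: eq_big_nat => m /andP[m1 mp]; congr F; lia.
Qed.

(** Reflecting the left distances by [d -> M - d] makes them continue the right ones: every row of a
    symmetric circulant has the same sum. *)
Lemma sum_ndist_sym {R : realType} (M i : nat) (g : nat -> R) : (i < M)%N ->
  (forall d, (0 < d < M)%N -> g (M - d)%N = g d) ->
  \sum_(0 <= d < i.+1) g d + \sum_(1 <= d < M - i) g d = \sum_(0 <= d < M) g d.
Proof.
move=> iM gs; rewrite big_ltn// [RHS]big_ltn; last exact: leq_ltn_trans iM.
rewrite -addrA; congr (_ + _); rewrite addrC.
rewrite [RHS](big_cat_nat (n := (M - i)%N))//=; [|lia|lia].
congr (_ + _); rewrite big_nat_rev/=.
have -> : (M - i = 1 + (M - i.+1))%N by lia.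
rewrite big_addn; have -> : (M - (M - i.+1) = i.+1)%N by lia.
apply: eq_big_nat => d /andP[d1 di]; rewrite -gs; last by lia.
by congr g; lia.
Qed.

Lemma sqbound_distmx {R : realType} (M : nat) (f : nat -> R) (r : R) : 0 <= r ->
  (forall i : 'I_M, \sum_(0 <= d < i.+1) `|f d| + \sum_(1 <= d < M - i) `|f d| <= r) ->
  sqbound (distmx M f) (r ^+ 2).
Proof.
move=> r0 h; have row i : \sum_j `|distmx M f i j| <= r.
  under eq_bigr do rewrite mxE.
  by rewrite (sum_ndist M (fun d => `|f d|)).
apply: schur_test => // j; rewrite (le_trans _ (row j))//.
by under eq_bigr do rewrite -tr_distmx mxE.
Qed.

Lemma distmx_coercive {R : realType} (M : nat) (f : nat -> R) (c : R) : 0 <= f 0%N ->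
  (forall i : 'I_M, \sum_(0 <= d < i.+1) `|f d| + \sum_(1 <= d < M - i) `|f d| <= 2 * f 0%N - c) ->
  forall v, c * normsq v <= dotv v (distmx M f *m v).
Proof.
move=> f0 h; apply: diag_dominant_coercive; first exact: tr_distmx.
  by move=> i; rewrite mxE /ndist subnn.
move=> i; under eq_bigr do rewrite mxE.
rewrite (sum_ndist M (fun d => `|f d|)) mxE /ndist subnn.
by have := h i; lra.
Qed.

Lemma mxrank_mxsub_le {R : realType} {m n m' n' : nat} (f : 'I_m' -> 'I_m) (g : 'I_n' -> 'I_n)
  (A : 'M[R]_(m, n)) : (\rank (mxsub f g A) <= \rank A)%N.
Proof.
have -> : mxsub f g A = rowsub f (colsub g A) by apply/matrixP => i j; rewrite !mxE.
rewrite (leq_trans (mxrankS (rowsub_sub _ _)))//.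
rewrite -[X in colsub g X]mulmx1 -mulmx_colsub; exact: mxrankM_maxl.
Qed.

(* Only the two opposite triangular corners of size [k] survive; together they
   form, after a column shift, a block diagonal matrix with triangular blocks. *)
Lemma mxrank_distmx {R : realType} (M k : nat) (f : nat -> R) : (k + k <= M)%N ->
  (forall d, (d < M - k)%N -> f d = 0) -> f (M - k)%N != 0 ->
  \rank (distmx M f) = (k + k)%N.
Proof.
move=> kM f0 fk.
have lo (a : 'I_k) : (a < M)%N by have := ltn_ord a; lia.
have hi (a : 'I_k) : (M - k + a < M)%N by have := ltn_ord a; lia.
pose phi (a : 'I_(k + k)) : 'I_M :=
  match fintype.split a with inl b => Ordinal (lo b) | inr b => Ordinal (hi b) end.
pose psi (a : 'I_(k + k)) : 'I_M :=
  match fintype.split a with inl b => Ordinal (hi b) | inr b => Ordinal (lo b) end.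
have phil b : phi (lshift k b) = Ordinal (lo b) by rewrite /phi (unsplitK (inl b)).
have phir b : phi (rshift k b) = Ordinal (hi b) by rewrite /phi (unsplitK (inr b)).
have psil b : psi (lshift k b) = Ordinal (hi b) by rewrite /psi (unsplitK (inl b)).
have psir b : psi (rshift k b) = Ordinal (lo b) by rewrite /psi (unsplitK (inr b)).
(* A lower triangular Toeplitz block with the constant diagonal [f (M - k)]. *)
pose B : 'M[R]_k := \matrix_(a, b) f (M - k + a - b)%N.
have uB : B \in unitmx.
  rewrite unitmxE det_trig; last first.
    by apply/is_trig_mxP => a b ab; rewrite mxE f0//; have := ltn_ord b; lia.
  rewrite unitfE; apply/prodf_neq0 => a _; rewrite mxE.
  by have -> : (M - k + a - a = M - k)%N by lia.
have subE : mxsub phi psi (distmx M f) = block_mx B^T 0 0 B.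
  apply/matrixP => a b; rewrite mxE.
  case: (splitP a) => a' ea; case: (splitP b) => b' eb.
  - have -> : a = lshift k a' by exact: val_inj.
    have -> : b = lshift k b' by exact: val_inj.
    rewrite phil psil block_mxEul !mxE; congr f; rewrite /ndist/=.
    by have := ltn_ord a'; lia.
  - have -> : a = lshift k a' by exact: val_inj.
    have -> : b = rshift k b' by exact: val_inj.
    rewrite phil psir block_mxEur !mxE f0// /ndist/=.
    by have := ltn_ord a'; have := ltn_ord b'; lia.
  - have -> : a = rshift k a' by exact: val_inj.
    have -> : b = lshift k b' by exact: val_inj.
    rewrite phir psil block_mxEdl !mxE f0// /ndist/=.
    by have := ltn_ord a'; have := ltn_ord b'; lia.
  - have -> : a = rshift k a' by exact: val_inj.
    have -> : b = rshift k b' by exact: val_inj.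
    rewrite phir psir block_mxEdr !mxE; congr f; rewrite /ndist/=.
    by have := ltn_ord b'; lia.
apply/eqP; rewrite eqn_leq; apply/andP; split; last first.
  apply: leq_trans (mxrank_mxsub_le phi psi _).
  by rewrite subE rank_diag_block_mx mxrank_tr mxrank_unit.
apply: (@leq_trans (\rank (rowsub phi (distmx M f)))); last exact: rank_leq_row.
(* For the upper bound, every row outside the first and last [k] is zero. *)
apply: mxrankS; apply/row_subP => i.
have rowE a : phi a = i -> (row i (distmx M f) <= rowsub phi (distmx M f))%MS.
  by move=> <-; rewrite -row_rowsub row_sub.
have [ik|ki] := ltnP i k.
  by apply: (rowE (lshift k (Ordinal ik))); rewrite phil; exact: val_inj.
have [iM|Mi] := leqP (M - k) i.
  have ik : (i - (M - k) < k)%N by have := ltn_ord i; lia.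
  by apply: (rowE (rshift k (Ordinal ik))); rewrite phir; apply: val_inj => /=; lia.
have -> : row i (distmx M f) = 0.
  apply/rowP => j; rewrite !mxE f0// /ndist.
  by have := ltn_ord j; lia.
exact: sub0mx.
Qed.

(** * Toeplitz matrix versus Strang's circulant *)

Lemma toeplitzT_distmx {R : realType} (alpha mu : R) (M : nat) :
  toeplitzT alpha mu M = distmx M (fun d => mu * coef alpha d%:Z).
Proof.
apply/matrixP => i j; rewrite !mxE; congr (_ * _).
have [ij|ji] := leqP i j.
  by rewrite -coefN; congr coef; rewrite /ndist; lia.
by congr coef; rewrite /ndist; lia.
Qed.

Lemma strang_entry_sym {R : realType} (alpha : R) (p d : nat) : (0 < d < p + p)%N ->
  strang_entry alpha (p + p) (p + p - d) = strang_entry alpha (p + p) d.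
Proof.
move=> /andP[d0 dM]; rewrite /strang_entry addnn doubleK.
have [dp|dp|->] := ltngtP d p.
- rewrite ltnNge ltnW/=; last by lia.
  by rewrite gtn_eqF; [congr coef; lia|lia].
- by have -> : (p.*2 - d < p)%N by lia.
- by rewrite ifF; [rewrite ifT//; lia|lia].
Qed.

Lemma strangC_distmx {R : realType} (alpha mu : R) (p : nat) :
  strangC alpha mu (p + p) = distmx (p + p) (fun d => mu * strang_entry alpha (p + p) d).
Proof.
apply/matrixP => i j; rewrite !mxE; congr (_ * _).
have := ltn_ord i; have := ltn_ord j => jM iM.
have [ij|ji] := leqP i j.
  have -> : (j + (p + p) - i = (j - i) + (p + p))%N by lia.
  by rewrite modnDr modn_small; [congr strang_entry; rewrite /ndist; lia|lia].
rewrite modn_small; last by lia.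
(* Below the diagonal the cyclic shift gives the index [M - |i - j|]. *)
rewrite -strang_entry_sym; last by rewrite /ndist; lia.
by congr strang_entry; rewrite /ndist; lia.
Qed.

Section CoefSums.
Context {R : realType} (alpha : R) (a0 : 0 < alpha) (a2 : alpha < 2).

Lemma sum_coef1 (n : nat) : \sum_(1 <= k < n.+1) `|coef alpha k%:Z| =
  coef alpha 0 / 2 - coef_tail alpha n.+1.
Proof. by rewrite sum_coef// coef_tail1. Qed.

Lemma sum_coef0 (n : nat) : \sum_(0 <= k < n.+1) `|coef alpha k%:Z| =
  3 / 2 * coef alpha 0 - coef_tail alpha n.+1.
Proof.
rewrite big_ltn// sum_coef1 ger0_norm; last by rewrite ltW ?coef0_gt0.
lra.
Qed.

(** Both ranges are extended to length [M]. The deficit from [2 c_0] becomes the coercivity constant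
    of [T]. *)
Lemma sum_toeplitz_row (M i : nat) : (i < M)%N ->
  \sum_(0 <= d < i.+1) `|coef alpha d%:Z| + \sum_(1 <= d < M - i) `|coef alpha d%:Z|
  <= 2 * coef alpha 0 - 2 * coef_tail alpha M.
Proof.
case: M => // M iM.
have h1 : \sum_(0 <= d < i.+1) `|coef alpha d%:Z| <= \sum_(0 <= d < M.+1) `|coef alpha d%:Z|.
  by rewrite [leRHS](big_cat_nat (n := i.+1))//= lerDl sumr_ge0.
have h2 : \sum_(1 <= d < M.+1 - i) `|coef alpha d%:Z| <= \sum_(1 <= d < M.+1) `|coef alpha d%:Z|.
  rewrite [leRHS](big_cat_nat (n := (M.+1 - i)%N))//=; [|lia|lia].
  by rewrite lerDl sumr_ge0.
by move: h1 h2; rewrite [in X in (_ <= X) -> _]sum_coef0 => h1; rewrite [leRHS]sum_coef1; lra.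
Qed.

Lemma sum_strang_row (p i : nat) : (0 < p)%N -> (i < p + p)%N ->
  \sum_(0 <= d < i.+1) `|strang_entry alpha (p + p) d| +
  \sum_(1 <= d < p + p - i) `|strang_entry alpha (p + p) d|
  = 2 * coef alpha 0 - 2 * coef_tail alpha p.
Proof.
move=> p0 iM; rewrite sum_ndist_sym//; last by move=> d dM; rewrite strang_entry_sym.
rewrite (big_cat_nat (n := p))//=; last exact: leq_addr.
have -> : \sum_(0 <= d < p) `|strang_entry alpha (p + p) d| = \sum_(0 <= d < p) `|coef alpha d%:Z|.
  by apply: eq_big_nat => d /andP[_ dp]; rewrite /strang_entry addnn doubleK dp.
have -> : \sum_(p <= d < p + p) `|strang_entry alpha (p + p) d| = \sum_(1 <= d < p) `|coef alpha d%:Z|.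
  rewrite big_ltn; last by lia.
  rewrite {1}/strang_entry addnn doubleK ltnn eqxx normr0 add0r -addnn.
  pose F m : R := if (m < p)%N then `|coef alpha m%:Z| else 0.
  transitivity (\sum_(p <= d < p + p) F (p + p - d)%N).
    rewrite [RHS]big_ltn; last by lia.
    rewrite /F {1}addnK ltnn add0r; apply: eq_big_nat => d /andP[pd dM].
    by rewrite -strang_entry_sym /strang_entry ?addnn ?doubleK; [|lia]; have -> : (p.*2 - d < p)%N by lia.
  rewrite sum_nat_mirror// big_nat_recr//= /F ltnn addr0.
  by apply: eq_big_nat => d /andP[_ ->].
by case: p p0 iM => // p _ _; rewrite sum_coef0 sum_coef1; lra.
Qed.

(* The entry of [T - C] at distance [d] from the diagonal, divided by [mu]. *)
Definition strang_defect (p d : nat) : R := coef alpha d%:Z - strang_entry alpha (p + p) d.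

Lemma strang_defect_small (p d : nat) : (d < p)%N -> strang_defect p d = 0.
Proof. by move=> dp; rewrite /strang_defect /strang_entry addnn doubleK dp subrr. Qed.

(** At [d = p] the circulant entry is 0 and the defect is [c_p]; beyond, it is a difference of two
    negative coefficients, the subtracted one being larger in absolute value. The strict lower bound
    serves the rank. *)
Lemma strang_defect_bound (p d : nat) : (0 < p)%N -> (p <= d < p + p)%N ->
  0 < `|strang_defect p d| <= `|coef alpha (p + p - d)%N%:Z|.
Proof.
move=> p0 /andP[pd dM]; rewrite /strang_defect /strang_entry addnn doubleK.
rewrite ltnNge pd/=; case: eqVneq => [->|dp].
  rewrite subr0 -addnn addnK lexx andbT.
  by case: p p0 {pd dM} => // p _; exact: coef_abs_gt0.
have [m em] : exists m, (p.*2 - d = m.+1)%N by exists (p.*2 - d).-1; lia.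
have [n en] : exists n, d = n.+1 by exists d.-1; lia.
rewrite em en; have mn : (m < n)%N by move: dp => /eqP; lia.
have := coef_abs_decr alpha m n a0 a2 mn.
have c1 := coef_lt0 alpha m a0 a2; have c2 := coef_lt0 alpha n a0 a2.
rewrite (ltr0_norm c1) (ltr0_norm c2) => h.
by rewrite ger0_norm; [apply/andP; split; lra|lra].
Qed.

(** The predicate acts on the mirrored index [M - d], so that the kept and the discarded diagonals
    are handled at once. *)
Lemma sum_strang_defect (p i : nat) (P : pred nat) : (0 < p)%N -> (i < p + p)%N ->
  \sum_(0 <= d < i.+1) `|if P (p + p - d)%N then strang_defect p d else 0| +
  \sum_(1 <= d < p + p - i) `|if P (p + p - d)%N then strang_defect p d else 0|
  <= \sum_(1 <= m < p.+1 | P m) `|coef alpha m%:Z|.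
Proof.
move=> p0 iM.
apply: le_trans (sum_ndist_sub (p + p) p i _ _ _ (leqnn _) iM) _ => //.
  by move=> d dp; rewrite strang_defect_small// if_same normr0.
rewrite [leRHS]big_mkcond/= -(sum_nat_mirror p (fun m => if P m then `|coef alpha m%:Z| else 0))//.
rewrite !big_nat; apply: ler_sum => d dp; case: ifP => _; last by rewrite normr0.
by have /andP[_] := strang_defect_bound p d p0 dp.
Qed.

Lemma sum_strang_defect_near (p k i : nat) : (k <= p)%N -> (0 < p)%N -> (i < p + p)%N ->
  \sum_(0 <= d < i.+1) `|if (p + p - d <= k)%N then strang_defect p d else 0| +
  \sum_(1 <= d < p + p - i) `|if (p + p - d <= k)%N then strang_defect p d else 0|
  <= coef alpha 0 / 2 - coef_tail alpha (p + p).
Proof.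
move=> kp p0 iM; apply: le_trans (sum_strang_defect p i (fun m => m <= k)%N p0 iM) _.
rewrite big_mkcond/=.
have h : \sum_(1 <= m < p.+1) (if (m <= k)%N then `|coef alpha m%:Z| else 0) <=
    \sum_(1 <= m < p.+1) `|coef alpha m%:Z| by apply: ler_sum => m _; case: ifP.
apply: (le_trans h).
have [q eq] : exists q, (p + p = q.+1)%N by exists (p + p).-1; lia.
(* The sum is enlarged up to index [M - 1], so that the tail at [M] appears. *)
rewrite eq -sum_coef1 [leRHS](big_cat_nat (n := p.+1))//=; last by lia.
by rewrite lerDl sumr_ge0.
Qed.

Lemma sum_strang_defect_far (p k i : nat) : (k <= p)%N -> (0 < p)%N -> (i < p + p)%N ->
  \sum_(0 <= d < i.+1) `|if (k < p + p - d)%N then strang_defect p d else 0| +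
  \sum_(1 <= d < p + p - i) `|if (k < p + p - d)%N then strang_defect p d else 0|
  <= coef_tail alpha k.+1.
Proof.
move=> kp p0 iM; apply: le_trans (sum_strang_defect p i (fun m => k < m)%N p0 iM) _.
rewrite big_mkcond/= (big_cat_nat (n := k.+1))//=.
rewrite big_nat big1 ?add0r; last by move=> m /andP[_ mk]; rewrite ltnNge -ltnS mk.
rewrite (eq_big_nat _ _ (F2 := fun m => `|coef alpha m%:Z|)); last by move=> m /andP[->].
by rewrite sum_coef// lerBlDr lerDl coef_tail_ge0.
Qed.
End CoefSums.

(** * Comparison with the constants of the statement *)

Lemma sqr_xi_ge {R : realType} (m K L L' lC lC' lT lT' : R) : 1 <= m ->
  0 <= L -> L <= L' -> 0 <= lC' -> lC' <= lC -> 0 <= lT' -> lT' <= lT ->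
  K = (1 + lC ^+ 2)^-1 * ((1 + lT ^+ 2)^-1 * (4 * (1 + L ^+ 2))) ->
  K <= (2 * Num.sqrt m * Num.sqrt (1 + L' ^+ 2) /
    (Num.sqrt (1 + lC' ^+ 2) * Num.sqrt (1 + lT' ^+ 2))) ^+ 2.
Proof.
move=> m1 L0 LL C0 CC T0 TT ->.
have pos (z : R) : 0 < 1 + z ^+ 2 by rewrite ltr_wpDr// sqr_ge0.
have mono (y z : R) : 0 <= y -> y <= z -> 1 + y ^+ 2 <= 1 + z ^+ 2.
  by move=> y0 yz; rewrite lerD2l lerXn2r ?nnegrE//; lra.
rewrite expr_div_n !exprMn !sqr_sqrtr ?(ltW (pos _))//; last by lra.
have iC : (1 + lC ^+ 2)^-1 <= (1 + lC' ^+ 2)^-1 by rewrite lef_pV2 ?posrE//; exact: mono.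
have iT : (1 + lT ^+ 2)^-1 <= (1 + lT' ^+ 2)^-1 by rewrite lef_pV2 ?posrE//; exact: mono.
have hL := mono L L' L0 LL; have pL := pos L.
have h1 : 4 * (1 + L ^+ 2) <= 2 ^+ 2 * m * (1 + L' ^+ 2).
  have -> : 2 ^+ 2 * m * (1 + L' ^+ 2) = 4 * (m * (1 + L' ^+ 2)) by ring.
  rewrite ler_pM2l// -[leLHS]mul1r ler_pM//; exact: ltW.
have p4 : 0 <= 4 * (1 + L ^+ 2) by rewrite mulr_ge0// ltW.

have iC0 : 0 <= (1 + lC ^+ 2)^-1 by rewrite invr_ge0 ltW.
have iT0 : 0 <= (1 + lT ^+ 2)^-1 by rewrite invr_ge0 ltW.
have h2 := ler_pM iT0 p4 iT h1.
apply: le_trans (ler_pM iC0 (mulr_ge0 iT0 p4) iC h2) _.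
by rewrite invfM [leRHS]mulrC -[leRHS]mulrA.
Qed.

(** With [M = 2 p] the lower bound on [eps] reads [mu th0 / (p - 1)^alpha < eps], so the ceiling is
    at most [p - 1] and the two corners of size [k0 = n + 2] do not overlap. The upper bound on
    [eps] makes the ceiling positive. *)
Lemma truncation_index {R : realType} (alpha mu th0 eps : R) (p : nat) :
  1 < alpha -> 0 < mu -> 0 < th0 -> (1 < p)%N ->
  powR 2 alpha * mu * th0 / powR ((p + p)%:R - 2) alpha < eps -> eps <= mu * th0 ->
  exists n : nat, [/\ Num.ceil (powR (mu * th0 / eps) alpha^-1) = n.+1%:Z,
    (n.+2 <= p)%N & mu * (th0 / powR n.+1%:R alpha) <= eps].
Proof.
move=> a1 mu0 t0 p1 h1 h2.
have a0 : 0 < alpha by lra.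
have mt : 0 < mu * th0 by exact: mulr_gt0.
have p1R : 2 <= p%:R :> R by rewrite ler_nat.
have pE : (p + p)%:R - 2 = 2 * (p%:R - 1) :> R by rewrite natrD; lra.
have pp : 0 < powR (p%:R - 1 : R) alpha by apply: powR_gt0; lra.
have h1' : mu * th0 / powR (p%:R - 1) alpha < eps.
  move: h1; rewrite pE powRM//; last lra.
  have q : 0 < powR (2 : R) alpha by exact: powR_gt0.
  rewrite invfM; apply: le_lt_trans; rewrite le_eqVlt; apply/orP; left; apply/eqP.
  by field; rewrite !gt_eqF.
have eps0 : 0 < eps by apply: le_lt_trans h1'; rewrite divr_ge0// ltW.
set rho := powR _ _.
have r1 : 1 <= rho.
  have e1 : powR 1 alpha^-1 = 1 :> R by rewrite powR1.
  rewrite /rho -[leLHS]e1; apply: ge0_ler_powR; rewrite ?nnegrE ?invr_ge0//.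
  - exact: ltW.
  - by rewrite divr_ge0// ltW.
  - by rewrite ler_pdivlMr// mul1r.
have rhoa : powR rho alpha = mu * th0 / eps.
  by rewrite /rho -powRrM mulVf ?gt_eqF// powRr1// divr_ge0// ltW.
have rp : rho <= p%:R - 1.
  rewrite leNgt; apply/negP => h.
  have : powR (p%:R - 1) alpha <= powR rho alpha.
    by rewrite ge0_ler_powR ?nnegrE//; lra.
  rewrite rhoa ler_pdivlMr// => h'.
  move: h1'; rewrite ltr_pdivrMr//; lra.
have c0 : 0 < Num.ceil rho by rewrite ceil_gt0; lra.
have cp : Num.ceil rho <= p%:Z - 1 by rewrite ceil_le_int// rmorphB/=.
have [n e] : exists n : nat, Num.ceil rho = n.+1%:Z.
  by move: c0; case: (Num.ceil rho) => [[|n]|n]// _; exists n.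
exists n; split => //.
  by move: cp; rewrite e; clear; lia.
have rn : rho <= n.+1%:R by have := ceil_ge rho; rewrite e.
rewrite mulrA ler_pdivrMr ?powR_gt0// [leRHS]mulrC -ler_pdivrMr// -rhoa.
by rewrite ge0_ler_powR ?nnegrE//; lra.
Qed.

Lemma row_sum_scale {R : realType} (mu r : R) (M i : nat) (f : nat -> R) : 0 < mu ->
  \sum_(0 <= d < i.+1) `|f d| + \sum_(1 <= d < M - i) `|f d| <= r ->
  \sum_(0 <= d < i.+1) `|mu * f d| + \sum_(1 <= d < M - i) `|mu * f d| <= mu * r.
Proof.
move=> mu0 h.
have e a b : \sum_(a <= d < b) `|mu * f d| = mu * \sum_(a <= d < b) `|f d|.
  by rewrite mulr_sumr; apply: eq_bigr => d _; rewrite normrM gtr0_norm.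
by rewrite !e -mulrDr ler_pM2l.
Qed.

(** The shift is absorbed into the entry at distance 0, so that the Schur test applies directly. *)
Lemma sqbound_scalarD_distmx {R : realType} (M : nat) (f : nat -> R) (w r : R) :
  0 <= w -> 0 <= r ->
  (forall i : 'I_M, \sum_(0 <= d < i.+1) `|f d| + \sum_(1 <= d < M - i) `|f d| <= r) ->
  sqbound (w%:M + distmx M f) ((w + r) ^+ 2).
Proof.
move=> w0 r0 h; pose u (d : nat) : R := if d == 0%N then w else 0.
have -> : w%:M + distmx M f = distmx M (fun d => u d + f d).
  apply/matrixP => i j; rewrite !mxE; congr (_ + _); rewrite /u /ndist -val_eqE/=.
  rewrite addn_eq0 !subn_eq0 -eqn_leq.
  by case: eqP.
apply: sqbound_distmx => [|i]; first exact: addr_ge0.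
have u0 d : `|u d| = u d by rewrite ger0_norm// /u; case: eqP.
have le a b : \sum_(a <= d < b) `|u d + f d| <= \sum_(a <= d < b) u d + \sum_(a <= d < b) `|f d|.
  by rewrite -big_split/=; apply: ler_sum => d _; rewrite -{2}(u0 d) ler_normD.
have u1 b : \sum_(1 <= d < b) u d = 0.
  by rewrite big_nat big1// => d /andP[d1 _]; rewrite /u gtn_eqF.
have := le 0%N i.+1; have := le 1%N (M - i)%N.
rewrite [\sum_(0 <= d < i.+1) u d]big_ltn// !u1 /u eqxx.
by have := h i; lra.
Qed.

Lemma coef_tail_gt0 {R : realType} (alpha : R) (m : nat) : 0 < alpha -> alpha < 2 ->
  0 < coef_tail alpha m.+1.
Proof.
move=> a0 a2; rewrite /coef_tail divr_gt0// mulr_gt0 ?coef_abs_gt0//.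
by rewrite addr_gt0// divr_gt0.
Qed.

Theorem theorem5 (R : realType) (alpha gamma tau a b omega eps : R) (M : nat)
  (D : 'M[R]_M) :
  1 < alpha -> alpha < 2 -> 0 < gamma -> 0 < tau -> a < b ->
  (8 <= M)%N -> ~~ odd M ->
  (forall i j : 'I_M, i != j -> D i j = 0) ->
  (forall i : 'I_M, D i i <= 0) ->
  0 < omega ->
  let h := (b - a) / (M.+1)%:R in
  let mu := gamma * tau / powR h alpha in
  let th := theta alpha in
  let th0 := theta0 alpha in
  let xi :=
    2 * Num.sqrt (M%:R)
    * Num.sqrt (1 + (omega + 2 * (Gamma (alpha + 1) * mu / (Gamma (alpha / 2 + 1)) ^+ 2
                                  - th * gamma * tau / powR (b - a) alpha)) ^+ 2)
    / (Num.sqrt (1 + (omega + powR 2 (alpha + 1) * gamma * tau * th / powR (b - a) alpha) ^+ 2)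
       * Num.sqrt (1 + (omega + 2 * gamma * tau * th / powR (b - a) alpha) ^+ 2)) in
  powR 2 alpha * mu * th0 / powR (M%:R - 2) alpha < eps ->
  eps <= mu * th0 ->
  let k0 : int := Num.ceil (powR (mu * th0 / eps) alpha^-1) + 1 in
  let T := toeplitzT alpha mu M in
  let C := strangC alpha mu M in
  let Rm : 'M[R]_(M + M) := block_mx (T - D) (- 1%:M) 1%:M (T - D) in
  let Bm : 'M[R]_(M + M) := block_mx (- D) 0 0 (- D) in
  let Hm : 'M[R]_(M + M) := block_mx T (- 1%:M) 1%:M T in
  let Cm : 'M[R]_(M + M) := block_mx C (- 1%:M) 1%:M C in
  let F : 'M[R]_(M + M) := (2 * omega)^-1 *: ((omega%:M + Bm) *m (omega%:M + Hm)) in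
  let Ft : 'M[R]_(M + M) := (2 * omega)^-1 *: ((omega%:M + Bm) *m (omega%:M + Cm)) in
  exists Mw Nw : 'M[R]_(M + M),
    (\rank Mw)%:Z = 4 * k0 /\
    spec_norm Mw <= mu * xi * (coef alpha 0 / 2 - th / powR (M%:R - 2^-1) alpha) /\
    spec_norm Nw <= xi * eps /\
    invmx Ft *m Rm = invmx F *m Rm + Mw + Nw.
Proof.
move=> a1 a2 g0 t0 ab M8 Mev.
have [p Mp] : exists p, M = (p + p)%N by exists M./2; rewrite addnn even_halfK.
subst M => Doff Ddiag w0 h mu th th0 xi hlo hhi k0 T C Rm Bm Hm Cm F Ft.
have a0 : 0 < alpha by lra.
have p4 : (4 <= p)%N by clear -M8; lia.
have p4R : 4 <= p%:R :> R by rewrite ler_nat.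
have M1R : (p + p).+1%:R = 2 * p%:R + 1 :> R by rewrite -natr1 natrD; lra.
have ba0 : 0 < b - a by lra.
have M10 : 0 < (p + p).+1%:R :> R by [].
have h0 : 0 < h by rewrite divr_gt0.
have ph0 : 0 < powR h alpha by exact: powR_gt0.
have mu0 : 0 < mu by rewrite divr_gt0// mulr_gt0.
have pM : 0 < powR (p + p).+1%:R alpha :> R by exact: powR_gt0.
have baE : powR (b - a) alpha = powR h alpha * powR (p + p).+1%:R alpha.
  by rewrite -powRM ?(ltW h0)//; congr powR; rewrite /h divfK.
have muE : gamma * tau / powR (b - a) alpha = mu / powR (p + p).+1%:R alpha.
  by rewrite baE invfM mulrA.
have th_ge0 : 0 <= th by exact: theta_ge0.
have th0_gt0 : 0 < th0 by exact: theta0_gt0.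
have tail_ge m (y : R) : (1 < m)%N -> 0 < y -> m%:R <= 16 / 15 * y ->
    th / powR y alpha <= coef_tail alpha m.
  by case: m => [|[|m]]// _; exact: coef_tail_ge.
set tM := coef_tail alpha (p + p); set tp := coef_tail alpha p.
have tail_gt0 m : (0 < m)%N -> 0 < coef_tail alpha m.
  by case: m => // m _; exact: coef_tail_gt0.
have tM0 : 0 < tM by apply: tail_gt0; clear -p4; lia.
have MR : (p + p)%:R = 2 * p%:R :> R by rewrite natrD; lra.
have p1 : (1 < p + p)%N by clear -p4; lia.
have tM1 : th / powR (p + p).+1%:R alpha <= tM.
  by apply: tail_ge => //; rewrite MR M1R; lra.
have tM2 : th / powR ((p + p)%:R - 2^-1) alpha <= tM.
  by apply: tail_ge => //; rewrite MR; lra.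
(* [M + 1 = 2 (p + 1/2)] accounts for the power of 2 in the first denominator of [xi]. *)
have tp1 : powR 2 alpha * th / powR (p + p).+1%:R alpha <= tp.
  have : th / powR (p%:R + 2^-1) alpha <= tp.
    by apply: tail_ge; [clear -p4; lia|lra|lra].
  have -> : powR (p + p).+1%:R alpha = powR 2 alpha * powR (p%:R + 2^-1) alpha :> R.
    by rewrite -powRM; [congr powR; rewrite M1R; lra|lra|lra].
  by rewrite invfM mulrACA mulfV ?mul1r// gt_eqF// powR_gt0.
have [n [ceilE np nle]] := truncation_index alpha mu th0 eps p a1 mu0 th0_gt0
  (ltac:(clear -p4; lia)) hlo hhi.
(* Here [n.+2] is [k0]: [fX] keeps the outermost [k0] diagonals on each side. *)
pose fX d : R := mu * (if (p + p - d <= n.+2)%N then strang_defect alpha p d else 0).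
pose fY d : R := mu * (if (n.+2 < p + p - d)%N then strang_defect alpha p d else 0).
have TE : T = _ := toeplitzT_distmx alpha mu (p + p).
have CE : C = _ := strangC_distmx alpha mu p.
have p0 : (0 < p)%N by clear -p4; lia.
pose x : R := mu * (coef alpha 0 / 2 - tM).
pose y : R := mu * coef_tail alpha n.+3.
(* Coercivity constants of [T] and [C]: twice the diagonal entry minus the absolute row sum. *)
pose lT : R := 2 * (mu * tM); pose lC : R := 2 * (mu * tp).
pose L : R := mu * (2 * coef alpha 0 - 2 * tM).
have tail_le_coef0 (m : nat) : (0 < m)%N -> coef_tail alpha m <= coef alpha 0 / 2.
  case: m => // m _; rewrite -subr_ge0 -(sum_coef1 alpha a0 a2) sumr_ge0//.
have tMc : tM <= coef alpha 0 / 2 by apply: tail_le_coef0; clear -p4; lia.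
have tp0 : 0 <= tp by exact: coef_tail_ge0.
have y0 : 0 <= y by rewrite mulr_ge0 ?ltW// coef_tail_gt0.
have x0 : 0 <= x by rewrite mulr_ge0 ?(ltW mu0)//; lra.
have L0 : 0 <= L by rewrite mulr_ge0 ?(ltW mu0)//; lra.
have lT0 : 0 < lT by rewrite mulr_gt0// mulr_gt0.
have lC0 : 0 <= lC by rewrite mulr_ge0// mulr_ge0// ltW.
have c0 := coef0_gt0 alpha a0.
have mc0 : 0 <= mu * coef alpha 0 by rewrite mulr_ge0// ltW.
have rowT (i : 'I_(p + p)) := row_sum_scale mu _ _ _ _ mu0
  (sum_toeplitz_row alpha a0 a2 (p + p) i (ltn_ord i)).
have rowC (i : 'I_(p + p)) : \sum_(0 <= d < i.+1) `|mu * strang_entry alpha (p + p) d| +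
    \sum_(1 <= d < p + p - i) `|mu * strang_entry alpha (p + p) d| <=
    mu * (2 * coef alpha 0 - 2 * tp).
  by apply: row_sum_scale => //; rewrite sum_strang_row.
have hT v : lT * normsq v <= dotv v (T *m v).
  rewrite TE; apply: distmx_coercive => // i; rewrite (le_trans (rowT i))// /lT -/tM.
  lra.
have hC v : lC * normsq v <= dotv v (C *m v).
  rewrite CE; apply: distmx_coercive => [|i].
    by rewrite /strang_entry addnn doubleK p0.
  rewrite (le_trans (rowC i))// /lC /strang_entry addnn doubleK p0.
  lra.
have hL : sqbound (omega%:M + T) ((omega + L) ^+ 2).
  by rewrite TE; apply: sqbound_scalarD_distmx => //; exact: ltW.
have TC : T - C = distmx _ fX + distmx _ fY.
  rewrite TE CE; apply/matrixP => i j; rewrite !mxE -mulrBr -mulrDr -/(strang_defect alpha p _).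
  by congr (_ * _); case: leqP => _; rewrite ?addr0 ?add0r.
have hX : sqbound (distmx (p + p) fX) (x ^+ 2).
  apply: sqbound_distmx => // i; apply: row_sum_scale => //.
  exact: sum_strang_defect_near.
have hY : sqbound (distmx (p + p) fY) (y ^+ 2).
  apply: sqbound_distmx => // i; apply: row_sum_scale => //.
  exact: sum_strang_defect_far.
have rX : \rank (distmx (p + p) fX) = (n.+2 + n.+2)%N.
  apply: mxrank_distmx; first by clear -np; lia.
    by move=> d dM; rewrite /fX ifF ?mulr0//; clear -dM; lia.
  have e : (p + p - (p + p - n.+2) = n.+2)%N by clear -np; lia.
  rewrite /fX e leqnn; apply: mulf_neq0; first by rewrite gt_eqF.
  have hb : (p <= p + p - n.+2 < p + p)%N by clear -np p0; lia.
  by rewrite -normr_gt0; have /andP[] := strang_defect_bound alpha a0 a2 p _ p0 hb.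
have [Mw [Nw [rM bM bN eq]]] := splitting_perturbation T C D _ _ omega lT lC L x y
  w0 lT0 lC0 (ltac:(rewrite TE; exact: tr_distmx)) (ltac:(rewrite CE; exact: tr_distmx))
  Doff Ddiag hT hC hL TC hX hY.
exists Mw, Nw.
set K := _ * (_ * (4 * _)) in bM bN.
have xi0 : 0 <= xi by rewrite /xi !mulr_ge0 ?invr_ge0 ?mulr_ge0 ?sqrtr_ge0.
have K0 : 0 <= K.
  by rewrite /K !mulr_ge0 ?invr_ge0// addr_ge0// sqr_ge0.
have Kxi : K <= xi ^+ 2.
  have e1 : th * gamma * tau / powR (b - a) alpha = mu * (th / powR (p + p).+1%:R alpha).
    by rewrite mulrCA -muE !mulrA.
  have e2 : powR 2 (alpha + 1) * gamma * tau * th / powR (b - a) alpha =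
      2 * (mu * (powR 2 alpha * th / powR (p + p).+1%:R alpha)).
    rewrite powRD ?powRr1//; last by rewrite pnatr_eq0 implybT.
    rewrite [mu * _]mulrCA -muE; ring.
  have e3 : 2 * gamma * tau * th / powR (b - a) alpha =
      2 * (mu * (th / powR (p + p).+1%:R alpha)).
    by rewrite [mu * _]mulrCA -muE; ring.
  have e4 : Gamma (alpha + 1) * mu / Gamma (alpha / 2 + 1) ^+ 2 = mu * coef alpha 0.
    by rewrite coef0E; ring.
  have q1 := ler_wpM2l (ltW mu0) tM1; have q2 := ler_wpM2l (ltW mu0) tp1.
  have q3 : 0 <= th / powR (p + p).+1%:R alpha by rewrite divr_ge0// ltW.
  have q4 : 0 <= powR 2 alpha * th / powR (p + p).+1%:R alpha.
    exact: divr_ge0 (mulr_ge0 (powR_ge0 _ _) th_ge0) (powR_ge0 _ _).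
  rewrite /xi e1 e2 e3 e4; apply: (sqr_xi_ge _ _ (omega + L) _ (omega + lC) _ (omega + lT)) => //.
  - by rewrite ler1n; clear -p4; lia.
  - by rewrite addr_ge0// ltW.
  - by rewrite lerD2l /L; lra.
  - exact: addr_ge0 (ltW w0) (mulr_ge0 (ler0n _ 2) (mulr_ge0 (ltW mu0) q4)).
  - by rewrite lerD2l /lC; lra.
  - exact: addr_ge0 (ltW w0) (mulr_ge0 (ler0n _ 2) (mulr_ge0 (ltW mu0) q3)).
  - by rewrite lerD2l /lT; lra.
have bound z z' : 0 <= z -> z <= z' -> K * z ^+ 2 <= (xi * z') ^+ 2.
  move=> z0 zz; rewrite exprMn ler_pM ?sqr_ge0// lerXn2r ?nnegrE//.
  exact: le_trans zz.
split; [|split; [|split]] => //.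
- by rewrite rM rX /k0 ceilE; clear; lia.
- have xx : x <= mu * (coef alpha 0 / 2 - th / powR ((p + p)%:R - 2^-1) alpha).
    by rewrite ler_pM2l// lerD2l lerN2.
  rewrite (mulrC mu) -mulrA; apply: spec_norm_le.
    by rewrite mulr_ge0// (le_trans x0).
  by apply: sqboundW bM; exact: bound.
- have yy : y <= eps.
    (* The tail starts at [k0 + 1 = n + 3], so [coef_tail_le] gives the power of [n + 2], which
       dominates that of [n + 1]. *)
    apply: le_trans nle; rewrite ler_pM2l// (le_trans (coef_tail_le alpha n.+1 a1 a2))//.
    rewrite ler_pM2l// lef_pV2 ?posrE ?powR_gt0// ge0_ler_powR ?nnegrE//; first exact: ltW.
    by rewrite ler_nat.
  apply: spec_norm_le; first by rewrite mulr_ge0// (le_trans y0).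
  by apply: sqboundW bN; exact: bound.
Qed.
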